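(* Keep the setting of the previous theorem: $\Omega\subseteq\mathbb{R}^d$, reversible Markov chains $M_i=(\Omega,P_i)$, $i\in[L]$, with stationary densities $p_i$; weights $r_i>0$ summing to $1$, $r=\min_ir_i/\max_ir_i$; the simulated tempering chain $M_{\mathrm{st}}$; finite measurable partitions $\mathcal P_i$ of $\Omega$ with $p_i(A)>0$ for all $A\in\mathcal P_i$ and $\mathcal P_1=\{\Omega\}$; and $\delta=\min_{1<i\le L,A\in\mathcal P_i}\big[\int_A\min\{p_{i-1},p_i\}\,dx\big]/p_i(A)$. Assume in addition that $\mathcal P_L\sqsubseteq\mathcal P_{L-1}\sqsubseteq\cdots\sqsubseteq\mathcal P_1$, i.e. each $\mathcal P_i$ refines $\mathcal P_{i-1}$ (every $A\in\mathcal P_i$ is contained in some $B\in\mathcal P_{i-1}$). Let $$\gamma=\min_{1\le i_1\le i_2\le L}\ \min_{A\in\mathcal P_{i_1}}\frac{p_{i_1}(A)}{p_{i_2}(A)}.$$ Then $$\operatorname{Gap}(M_{\mathrm{st}})\ \ge\ \frac{r^2\gamma\delta}{32L^3}\min_{1\le i\le L,\ A\in\mathcal P_i}\operatorname{Gap}(M_i|_A).$$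
   Context: A (discrete-time) Markov chain $M=(\Omega,P)$ has transition kernel $P(x,\cdot)$; $p$ is stationary if $\int p(x)P(x,\cdot)dx=p$, and $M$ is reversible if $p(x)P(x,dy)=p(y)P(y,dx)$. For $g\in L^2(p)$, $(Pg)(x)=\int g(y)P(x,dy)$, $\langle g,h\rangle_p=\int gh\,p$, the Dirichlet form is $\mathcal E_M(g)=\langle g,(I-P)g\rangle_p$, $\operatorname{Var}_p(g)=\|g-\int gp\|_p^2$, and the spectral gap is $\operatorname{Gap}(M)=\inf\{\mathcal E_M(g)/\operatorname{Var}_p(g): g\in L^2(p),\ \operatorname{Var}_p(g)>0\}$. Restriction: for measurable $A\subseteq\Omega$, $M|_A=(A,P|_A)$ with $P|_A(x,B)=P(x,B)+\mathbf 1_B(x)P(x,A^c)$ for $x\in A$, $B\subseteq A$; its stationary distribution is $p$ conditioned on $A$. Simulated tempering chain: state space $\Omega\times[L]$. From state $(x,k)$: with probability $1/2$ (Type 1) keep $k$ and move $x$ according to $P_k$; with probability $1/2$ (Type 2) draw $k'$ uniformly from $[L]$ and move to $(x,k')$ with probability $\min\{\frac{r_{k'}p_{k'}(x)}{r_kp_k(x)},1\}$, otherwise stay. Its stationary distribution is $p(x,i)=r_ip_i(x)$. *)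

(* Defs.v *)
From HB Require Import structures.
From mathcomp Require Import all_boot all_order all_algebra.
From mathcomp Require Import all_classical all_reals all_analysis.
Set Implicit Arguments. Unset Strict Implicit. Unset Printing Implicit Defensive.
Import Order.TTheory GRing.Theory Num.Theory.
Import numFieldNormedType.Exports.
Local Open Scope classical_set_scope.
Local Open Scope ring_scope.

Section MarkovDefs.
Context d (T : measurableType d) (R : realType) (mu : {measure set T -> \bar R}).

Definition pmass (p : T -> R) (A : set T) : R := Rintegral mu A p.

Definition is_density (p : T -> R) : Prop :=
  measurable_fun setT p /\ (forall x, 0 <= p x) /\
  (\int[mu]_x (p x)%:E = 1)%E.

Definition stationary (P : R.-pker T ~> T) (p : T -> R) : Prop :=
  forall B, measurable B ->
    (\int[mu]_x ((p x)%:E * P x B) = \int[mu]_(x in B) (p x)%:E)%E.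

Definition reversible (P : R.-pker T ~> T) (p : T -> R) : Prop :=
  forall B C, measurable B -> measurable C ->
    (\int[mu]_(x in B) ((p x)%:E * P x C) = \int[mu]_(y in C) ((p y)%:E * P y B))%E.

Definition L2 (p : T -> R) (g : T -> R) : Prop :=
  measurable_fun setT g /\ (\int[mu]_x ((g x ^+ 2 * p x)%:E) < +oo)%E.

Definition ip (p : T -> R) (g h : T -> R) : R := Rintegral mu setT (fun x => g x * h x * p x).
Definition mean (p : T -> R) (g : T -> R) : R := Rintegral mu setT (fun x => g x * p x).
Definition Var (p : T -> R) (g : T -> R) : R :=
  ip p (fun x => g x - mean p g) (fun x => g x - mean p g).

Definition Pop (P : R.-pker T ~> T) (g : T -> R) : T -> R :=
  fun x => Rintegral (P x) setT g.

Definition Dirichlet (p : T -> R) (Q : (T -> R) -> (T -> R)) (g : T -> R) : R :=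
  ip p g (fun x => g x - Q g x).

Definition gap_of (p : T -> R) (Q : (T -> R) -> (T -> R)) : R :=
  inf [set Dirichlet p Q g / Var p g | g in [set g | L2 p g /\ 0 < Var p g]].

Definition Gap (P : R.-pker T ~> T) (p : T -> R) : R := gap_of p (Pop P).

(* Restricted chain M|_A : stationary density p conditioned on A, and
   P|_A(x,B) = P(x,B) + 1_B(x) P(x,A^c), so that
   (P|_A g)(x) = int_A g(y) P(x,dy) + g(x) P(x,A^c).  Functions on A are
   represented by functions on T (values off A are irrelevant). *)
Definition cond_density (p : T -> R) (A : set T) : T -> R :=
  fun x => \1_A x * p x / pmass p A.
Definition restr_op (P : R.-pker T ~> T) (A : set T) (g : T -> R) : T -> R :=
  fun x => Rintegral (P x) A g + g x * fine (P x (~` A)).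
Definition Gap_restr (P : R.-pker T ~> T) (p : T -> R) (A : set T) : R :=
  gap_of (cond_density p A) (restr_op P A).

Definition good_partition (p : T -> R) (Pt : set (set T)) : Prop :=
  finite_set Pt /\ (forall A, Pt A -> measurable A /\ 0 < pmass p A) /\
  (forall A B, Pt A -> Pt B -> A <> B -> A `&` B = set0) /\
  \bigcup_(A in Pt) A = setT.

(* functions on T x 'I_L are curried: g : 'I_L -> T -> R ;
   stationary density p(x,i) = r_i p_i(x) w.r.t. mu (x) counting *)
Section ST.
Variables (L : nat) (Ps : 'I_L -> R.-pker T ~> T) (p : 'I_L -> T -> R) (r : 'I_L -> R).

Definition ip_st (g h : 'I_L -> T -> R) : R :=
  \sum_(i < L) r i * Rintegral mu setT (fun x => g i x * h i x * p i x).
Definition mean_st (g : 'I_L -> T -> R) : R :=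
  \sum_(i < L) r i * Rintegral mu setT (fun x => g i x * p i x).
Definition Var_st (g : 'I_L -> T -> R) : R :=
  ip_st (fun i x => g i x - mean_st g) (fun i x => g i x - mean_st g).
Definition L2_st (g : 'I_L -> T -> R) : Prop :=
  forall i, L2 (p i) (g i).

Definition accept (k k' : 'I_L) (x : T) : R :=
  if r k * p k x == 0 then 1 else Num.min ((r k' * p k' x) / (r k * p k x)) 1.

(* transition operator of the simulated tempering chain:
   with prob. 1/2 move x by P_k, with prob. 1/2 propose uniform k' and
   accept with probability accept k k' x *)
Definition st_op (g : 'I_L -> T -> R) : 'I_L -> T -> R :=
  fun k x => 2^-1 * Pop (Ps k) (g k) x +
    2^-1 * (L%:R^-1 * \sum_(k' < L) (accept k k' x * g k' x + (1 - accept k k' x) * g k x)).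

Definition Dirichlet_st (g : 'I_L -> T -> R) : R :=
  ip_st g (fun k x => g k x - st_op g k x).

Definition Gap_st : R :=
  inf [set Dirichlet_st g / Var_st g | g in [set g | L2_st g /\ 0 < Var_st g]].
End ST.

End MarkovDefs.

(* Main.v *)
(** A reversible chain satisfies E(g) = 1/2 int int (g x - g y)^2 p(x) P(x, dy),
    so dropping the jumps between cells shows that E_i(g_i) dominates
    sum_A p_i(A) E_{i|A}(g_i), hence gmin * V_i, where
    V_i = int (g_i - gb_i)^2 p_i and gb_i is the cell-wise average of g_i.
    The swap moves contribute int min(r_k p_k, r_k' p_k') (g_k - g_k')^2.

    The cells of the nested partitions form a tree rooted at P_1 = {Omega}.
    Bound the variance by the second moment around the constant c = gb_1, and
    telescope gb_i - c along levels by Cauchy-Schwarz.  Each increment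
    D_j = gb_j - gb_{j-1} is constant on the cells of P_j by refinement, so
    gamma moves int D_j^2 p_i to int D_j^2 p_j for i >= j, and delta moves the
    latter to int D_j^2 min(p_{j-1}, p_j), which is at most
    3 (V_j + V_{j-1} + int min(p_{j-1}, p_j) (g_j - g_{j-1})^2).
    Every term is now controlled by the Dirichlet form, using gmin <= 2 for the
    swap terms; the constant 32 leaves room for these crude estimates. *)

Require Import Defs.
From HB Require Import structures.
From mathcomp Require Import all_boot all_order all_algebra.
From mathcomp Require Import all_classical all_reals all_analysis.
From mathcomp Require Import measurable_realfun ring lra.
Import Order.TTheory GRing.Theory Num.Theory.
Import numFieldNormedType.Exports.
Set Implicit Arguments. Unset Strict Implicit. Unset Printing Implicit Defensive.
Local Open Scope classical_set_scope.
Local Open Scope ring_scope.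

(** * The joint law of two consecutive states *)

Section joint_measure.
Context d (T : measurableType d) (R : realType) (mu : {measure set T -> \bar R}).
Variables (p : T -> R) (P : R.-pker T ~> T).
Local Open Scope ereal_scope.

(* The unused density argument lets the measure structure be inferred. *)
Definition joint of is_density mu p := fun U : set (T * T) =>
  \int[mu]_x ((p x)%:E * P x (xsection U x)).

Hypothesis dp : is_density mu p.

Let mp : measurable_fun setT (fun x => (p x)%:E).
Proof. by case: dp => mp _; exact/measurable_EFinP. Qed.

Let p0 x : (0 <= p x)%R. Proof. by case: dp => _ []. Qed.

Lemma measurable_fun_xsection_pker (U : set (T * T)) : measurable U ->
  measurable_fun setT (fun x => P x (xsection U x)).
Proof. by move=> mU; apply: measurable_fun_xsection_finite_kernel; rewrite inE. Qed.

Let joint0 : joint dp set0 = 0.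
Proof.
rewrite /joint integral0_eq// => x _.
by rewrite xsection0 measure0 mule0.
Qed.

Let joint_ge0 U : 0 <= joint dp U.
Proof. by apply: integral_ge0 => x _; rewrite mule_ge0 ?lee_fin. Qed.

Let joint_sigma_additive : semi_sigma_additive (joint dp).
Proof.
move=> F mF tF mUF; rewrite [X in _ --> X](_ : _ =
    \int[mu]_x (\sum_(n <oo) (p x)%:E * P x (xsection (F n) x))); last first.
  apply: eq_integral => x _; rewrite nneseriesZl//.
  congr (_ * _); rewrite xsection_bigcup measure_semi_bigcup//.
  - by move=> n; exact: measurable_xsection.
  - exact: trivIset_xsection.
  - apply: bigcup_measurable => n _; exact: measurable_xsection.
rewrite /joint integral_nneseries//; last 2 first.
  - move=> n; apply: emeasurable_funM => //.
    exact: measurable_fun_xsection_pker.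
  - by move=> n x _; rewrite mule_ge0 ?lee_fin.
apply: is_cvg_nneseries => n _ _.
by apply: integral_ge0 => x _; rewrite mule_ge0 ?lee_fin.
Qed.

HB.instance Definition _ := isMeasure.Build _ _ _ (joint dp)
  joint0 joint_ge0 joint_sigma_additive.

Definition mjoint : {measure set (T * T) -> \bar R} := joint dp.

Lemma mjointT : mjoint setT = 1.
Proof.
rewrite /mjoint/= /joint; under eq_integral.
  move=> x _; rewrite (_ : xsection _ _ = setT); last first.
    by apply/seteqP; split => // y _; rewrite /xsection/= inE.
  by rewrite prob_kernel mule1; over.
by case: dp => _ [].
Qed.

Let mint (f : T * T -> \bar R) : (forall z, 0 <= f z) -> measurable_fun setT f ->
  measurable_fun setT (fun x => (p x)%:E * \int[P x]_y f (x, y)).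
Proof.
move=> f0 mf; apply: emeasurable_funM => //.
exact: measurable_fun_integral_finite_kernel.
Qed.

Import HBNNSimple.

Let ge0_integral_joint_indic U (mU : measurable U) :
  \int[mjoint]_z (\1_U z)%:E = \int[mu]_x ((p x)%:E * \int[P x]_y (\1_U (x, y))%:E).
Proof.
rewrite integral_indic//= setIT; apply: eq_integral => x _; congr (_ * _).
rewrite -[LHS]mul1e -integral_cst//; last exact: measurable_xsection.
rewrite integral_mkcond.
by apply: eq_integral => y _ /=; rewrite patchE mem_xsection indicE; case: ifPn.
Qed.

Let ge0_integral_joint_nnsfun (f : {nnsfun (T * T) >-> R}) :
  \int[mjoint]_z (f z)%:E = \int[mu]_x ((p x)%:E * \int[P x]_y (f (x, y))%:E).
Proof.
under [in LHS]eq_integral do rewrite fimfunE -fsumEFin//.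
rewrite ge0_integral_fsum//; last 2 first.
  - by move=> r; exact/measurable_EFinP/measurableT_comp.
  - by move=> r z _; rewrite EFinM nnfun_muleindic_ge0.
under [in RHS]eq_integral.
  move=> x _.
  under eq_integral do rewrite fimfunE -fsumEFin//.
  rewrite /= ge0_integral_fsum//; last 2 first.
    - move=> r; apply/measurable_EFinP/measurable_funM => //.
      by apply: measurableT_comp => //; exact: measurableT_comp.
    - by move=> r z _; rewrite EFinM nnfun_muleindic_ge0.
  rewrite ge0_mule_fsumr; last first.
    by move=> r; apply: integral_ge0 => y _; rewrite EFinM nnfun_muleindic_ge0.
  over.
rewrite /= ge0_integral_fsum//; last 2 first.
  (* A nonnegative simple function takes no negative value, so terms with [r < 0] vanish
     identically; [mint] handles the others. *)
  - move=> r; have [r0|r0] := leP 0%R r.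
      apply: (@mint (fun z => (r * \1_(f @^-1` [set r]) z)%:E)).
        by move=> z; rewrite EFinM nnfun_muleindic_ge0.
      exact/measurable_EFinP/measurableT_comp.
    rewrite (_ : (fun x => _) = cst 0)//; apply/funext => x/=.
    by rewrite integral0_eq ?mule0// => y _; rewrite preimage_nnfun0// indic0 mulr0.
  - move=> r x _; rewrite mule_ge0 ?lee_fin//.
    by apply: integral_ge0 => y _; rewrite EFinM nnfun_muleindic_ge0.
apply: eq_fsbigr => r _; have [r0|r0] := leP 0%R r; last first.
  have f0 z : (r * \1_(f @^-1` [set r]) z)%:E = 0.
    by rewrite preimage_nnfun0// indic0 mulr0.
  rewrite [LHS]integral0_eq; last by move=> z _; exact: f0.
  rewrite [RHS]integral0_eq// => x _.
  by rewrite integral0_eq ?mule0.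
transitivity (r%:E * \int[mjoint]_z (\1_(f @^-1` [set r]) z)%:E).
  rewrite -ge0_integralZl//; last exact/measurable_EFinP.
rewrite ge0_integral_joint_indic// -ge0_integralZl//.
- apply: eq_integral => x _; rewrite muleCA; congr (_ * _).
  rewrite -ge0_integralZl//; apply/measurable_EFinP.
  by apply: measurableT_comp => //; exact: measurableT_comp.
- apply: (@mint (fun z => (\1_(f @^-1` [set r]) z)%:E)) => //.
  exact/measurable_EFinP.
- move=> x _; rewrite mule_ge0 ?lee_fin//; exact: integral_ge0.
Qed.

(** Tonelli for [mu] followed by the kernel: simple functions come first, then monotone convergence
    is used under the joint law, under [mu] and under each [P x]. *)
Lemma ge0_integral_joint (f : T * T -> \bar R) :
  (forall z, 0 <= f z) -> measurable_fun setT f ->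
  \int[mjoint]_z f z = \int[mu]_x ((p x)%:E * \int[P x]_y f (x, y)).
Proof.
move=> f0 mf.
pose f_ := nnsfun_approx measurableT mf.
have mfx n x : measurable_fun setT (fun y => (f_ n (x, y))%:E).
  by apply/measurable_EFinP/measurableT_comp.
have ndI x : nondecreasing_seq (fun n => \int[P x]_y (f_ n (x, y))%:E).
  move=> a b ab; apply: ge0_le_integral => //.
  - by move=> z _; rewrite lee_fin.
  - by move=> z _; rewrite lee_fin; exact/lefP/nd_nnsfun_approx.
have If_ge0 n x : 0 <= \int[P x]_y (f_ n (x, y))%:E.
  by apply: integral_ge0 => y _; rewrite lee_fin.
transitivity (\int[mjoint]_z (lim ((f_ n z)%:E @[n --> \oo]))).
  by apply/eq_integral => z _; apply/esym/cvg_lim => //=; exact: cvg_nnsfun_approx.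
rewrite monotone_convergence//; last 3 first.
  by move=> n; exact/measurable_EFinP.
  by move=> n z _; rewrite lee_fin.
  by move=> z _ a b ab; rewrite lee_fin; exact/lefP/nd_nnsfun_approx.
under eq_fun do rewrite ge0_integral_joint_nnsfun.
transitivity (\int[mu]_x lim ((p x)%:E * (\int[P x]_y (f_ n (x, y))%:E) @[n --> \oo])).
  rewrite -monotone_convergence//.
  - move=> n; apply: (@mint (fun z => (f_ n z)%:E)); last exact/measurable_EFinP.
    by move=> z; rewrite lee_fin.
  - by move=> n x _; rewrite mule_ge0 ?lee_fin.
  - by move=> x _ a b ab; rewrite lee_wpmul2l ?lee_fin//; exact: ndI.
apply: eq_integral => x _; rewrite limeMl//; last first.
  exact: ereal_nondecreasing_is_cvgn.
congr (_ * _); rewrite -monotone_convergence//; last 2 first.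
  - by move=> n z _; rewrite lee_fin.
  - by move=> z _ a b ab; rewrite lee_fin; exact/lefP/nd_nnsfun_approx.
by apply: eq_integral => z _; apply/cvg_lim => //; exact: cvg_nnsfun_approx.
Qed.

End joint_measure.

(** * Integrals of real functions *)

Notation intg mu f := (mu.-integrable setT (EFin \o f)).

Section real_integral.
Context d (T : measurableType d) (R : realType) (mu : {measure set T -> \bar R}).
Implicit Types f g : T -> R.

Lemma intg_measurable f : intg mu f -> measurable_fun setT f.
Proof. by move=> /measurable_int/measurable_EFinP. Qed.

Lemma intg_lty f : measurable_fun setT f -> (forall x, 0 <= f x) ->
  (\int[mu]_x (f x)%:E < +oo)%E -> intg mu f.
Proof.
move=> mf f0 fy; apply/integrableP; split; first exact/measurable_EFinP.
by under eq_integral do rewrite gee0_abs ?lee_fin//.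
Qed.

Lemma intgD f g : intg mu f -> intg mu g -> intg mu (fun x => f x + g x).
Proof. by move=> fi gi; have := integrableD measurableT fi gi. Qed.

Lemma intgB f g : intg mu f -> intg mu g -> intg mu (fun x => f x - g x).
Proof. by move=> fi gi; have := integrableB measurableT fi gi. Qed.

Lemma intgZ k f : intg mu f -> intg mu (fun x => k * f x).
Proof. by move=> fi; have := integrableZl measurableT k fi. Qed.

Lemma intg_le f g : measurable_fun setT f -> intg mu g ->
  (forall x, `|f x| <= g x) -> intg mu f.
Proof.
move=> mf gi fg; apply: (le_integrable measurableT _ _ gi).
  exact/measurable_EFinP.
by move=> x _ /=; rewrite lee_fin (le_trans (fg x))// ler_norm.
Qed.

Lemma intg_sum (I : eqType) (s : seq I) (F : I -> T -> R) :
  (forall i, i \in s -> intg mu (F i)) -> intg mu (fun x => \sum_(i <- s) F i x).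
Proof.
elim: s => [_|i s ih Fi].
  by under eq_fun do rewrite big_nil; exact: integrable0.
under eq_fun do rewrite big_cons; apply: intgD; first exact/Fi/mem_head.
by apply: ih => j js; apply: Fi; rewrite inE js orbT.
Qed.

Lemma Rint_sum (I : eqType) (s : seq I) (F : I -> T -> R) :
  (forall i, i \in s -> intg mu (F i)) ->
  Rintegral mu setT (fun x => \sum_(i <- s) F i x) =
  \sum_(i <- s) Rintegral mu setT (F i).
Proof.
elim: s => [_|i s ih Fi].
  by under eq_fun do rewrite big_nil; rewrite big_nil Rintegral_cst// mul0r.
have Fs j : j \in s -> intg mu (F j) by move=> js; apply: Fi; rewrite inE js orbT.
under eq_fun do rewrite big_cons.
rewrite big_cons RintegralD ?ih//; first exact/Fi/mem_head.
exact: intg_sum.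
Qed.

Lemma Rint_le f g : intg mu f -> intg mu g -> (forall x, f x <= g x) ->
  Rintegral mu setT f <= Rintegral mu setT g.
Proof. by move=> fi gi fg; exact: le_Rintegral. Qed.

(** Kernel integrals can be split only at almost every [x]; this carries integrability and value
    across such an identity. *)
Lemma Rint_ae f g : measurable_fun setT g -> intg mu f ->
  {ae mu, forall x, f x = g x} ->
  intg mu g /\ Rintegral mu setT g = Rintegral mu setT f.
Proof.
move=> mg fi fg.
have mf := intg_measurable fi.
have fgE : ae_eq mu setT (EFin \o g) (EFin \o f).
  by apply: filterS fg => x /= -> _.
split; last first.
  by congr fine; apply: ae_eq_integral => //; exact/measurable_EFinP.
apply/integrableP; split; first exact/measurable_EFinP.
move/integrableP : fi => [_]; apply: le_lt_trans.
rewrite le_eqVlt; apply/orP; left; apply/eqP.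
apply: ae_eq_integral => //; [| |exact: ae_eq_abse];
  by apply: measurableT_comp => //; exact/measurable_EFinP.
Qed.

Lemma Rint_indic (A : set T) f :
  Rintegral mu A f = Rintegral mu setT (fun x => \1_A x * f x).
Proof.
rewrite Rintegral_mkcond; congr Rintegral; apply/funext => x.
by rewrite patchE indicE; case: ifPn; rewrite ?mul1r ?mul0r.
Qed.

Lemma intg_indic (A : set T) f : measurable A -> intg mu f ->
  intg mu (fun x => \1_A x * f x).
Proof.
move=> mA fi; apply: (@intg_le _ (fun x => `|f x|)).
- by apply: measurable_funM; [exact: measurable_indic|exact: intg_measurable fi].
- exact: integrable_norm.
- move=> x; rewrite normrM indicE; case: (x \in A); rewrite ?normr1 ?normr0 ?mul1r//.
  by rewrite mul0r.
Qed.

End real_integral.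

Ltac meas := repeat first [ assumption | exact: measurable_cst
  | exact: measurable_fst | exact: measurable_snd
  | apply: measurable_funB | apply: measurable_funD | apply: measurable_funM
  | apply: measurable_funX | apply: measurable_indic ].

(** * Disintegration and symmetry of the joint law *)

Section joint_theory.
Context d (T : measurableType d) (R : realType) (mu : {measure set T -> \bar R}).
Variables (p : T -> R) (P : R.-pker T ~> T) (dp : is_density mu p).

Let mp : measurable_fun setT p. Proof. by case: dp. Qed.
Let p0 x : 0 <= p x. Proof. by case: dp => _ []. Qed.

Local Notation pi := (mjoint P dp).

Let integralE_slice (F : T * T -> R) x : (\int[P x]_y (F (x, y))%:E =
  \int[P x]_y ((EFin \o F)^\+ (x, y)) - \int[P x]_y ((EFin \o F)^\- (x, y)))%E.
Proof.
rewrite integralE; congr (_ - _)%E; apply: eq_integral => y _.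
  by rewrite !funeposE.
by rewrite !funenegE.
Qed.

Lemma measurable_Rint_pker (F : T * T -> R) : measurable_fun setT F ->
  measurable_fun setT (fun x => Rintegral (P x) setT (fun y => F (x, y))).
Proof.
move=> mF; apply: measurableT_comp; first exact: fine_measurable.
have mF' : measurable_fun setT (EFin \o F) by exact/measurable_EFinP.
rewrite (_ : (fun x => _) = (fun x =>
    \int[P x]_y ((EFin \o F)^\+ (x, y)) - \int[P x]_y ((EFin \o F)^\- (x, y)))%E).
  by apply: emeasurable_funB; apply: measurable_fun_integral_finite_kernel => //;
    [exact: measurable_funepos|exact: measurable_funeneg].
by apply/funext => x; exact: integralE_slice.
Qed.

(** The alternative [p x = 0] is there because the inner integral may then be infinite without
    affecting the outer one, zero times infinity being zero. *)
Let pint_ae (f : T * T -> \bar R) : (forall z, 0 <= f z)%E ->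
  measurable_fun setT f -> (\int[pi]_z f z < +oo)%E ->
  {ae mu, forall x, p x = 0 \/ (\int[P x]_y f (x, y))%E \is a fin_num}.
Proof.
move=> f0 mf; rewrite ge0_integral_joint// => fy.
have f0' x : (0 <= (p x)%:E * \int[P x]_y f (x, y))%E.
  by rewrite mule_ge0 ?lee_fin//; exact: integral_ge0.
have /(integrable_ae measurableT) : mu.-integrable setT
    (fun x => (p x)%:E * \int[P x]_y f (x, y))%E.
  apply/integrableP; split; last by under eq_integral do rewrite gee0_abs//.
  apply: emeasurable_funM; first exact/measurable_EFinP.
  exact: measurable_fun_integral_finite_kernel.
apply: filterS => x /= /(_ I) pfin.
have [->|px] := eqVneq (p x) 0; [by left|right].
have I0 : (0 <= \int[P x]_y f (x, y))%E by exact: integral_ge0.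
have {}px : (0 < p x) by rewrite lt_neqAle eq_sym px p0.
move: pfin; rewrite !ge0_fin_numE// => pfin.
rewrite ltey; apply/negP => /eqP fe; move: pfin.
by rewrite fe gt0_muley ?lte_fin// ltxx.
Qed.

Lemma joint_ae_intg (F : T * T -> R) : intg pi F ->
  {ae mu, forall x, p x = 0 \/ intg (P x) (fun y => F (x, y))}.
Proof.
move=> iF; have mF := intg_measurable iF.
have mF' : measurable_fun setT (fun z => `|(EFin \o F) z|)%E.
  by apply: measurableT_comp => //; exact/measurable_EFinP.
have /integrableP[_ Fy] := iF.
apply: filterS (pint_ae (fun z => abse_ge0 _) mF' Fy) => x [->|Fx]; [by left|right].
apply/integrableP; split; last by move: Fx; rewrite ge0_fin_numE ?integral_ge0.
by apply/measurable_EFinP; exact: measurableT_comp.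
Qed.

(** Fubini for signed integrands. [Rintegral] sends a non-finite inner integral to a default value,
    but up to a null set this happens only where [p x = 0], and there the factor [p x] hides it. *)
Lemma Rint_joint (F : T * T -> R) : intg pi F ->
  intg mu (fun x => p x * Rintegral (P x) setT (fun y => F (x, y))) /\
  Rintegral mu setT (fun x => p x * Rintegral (P x) setT (fun y => F (x, y))) =
  Rintegral pi setT F.
Proof.
move=> iF; have mF := intg_measurable iF.
have mF' : measurable_fun setT (EFin \o F) by exact/measurable_EFinP.
pose f1 : T * T -> \bar R := (EFin \o F)^\+%E.
pose f2 : T * T -> \bar R := (EFin \o F)^\-%E.
have m1 : measurable_fun setT f1 by exact: measurable_funepos.
have m2 : measurable_fun setT f2 by exact: measurable_funeneg.
have f1y := integral_funepos_lt_pinfty measurableT iF.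
have f2y := integral_funeneg_lt_pinfty measurableT iF.
have f10 z : (0 <= f1 z)%E by rewrite /f1 funeposE le_max lexx orbT.
have f20 z : (0 <= f2 z)%E by rewrite /f2 funenegE le_max lexx orbT.
have i1 : mu.-integrable setT (fun x => (p x)%:E * \int[P x]_y f1 (x, y))%E.
  apply/integrableP; split.
    apply: emeasurable_funM; first exact/measurable_EFinP.
    exact: measurable_fun_integral_finite_kernel.
  under eq_integral do rewrite gee0_abs ?mule_ge0 ?lee_fin ?integral_ge0//.
  by rewrite -ge0_integral_joint.
have i2 : mu.-integrable setT (fun x => (p x)%:E * \int[P x]_y f2 (x, y))%E.
  apply/integrableP; split.
    apply: emeasurable_funM; first exact/measurable_EFinP.
    exact: measurable_fun_integral_finite_kernel.
  under eq_integral do rewrite gee0_abs ?mule_ge0 ?lee_fin ?integral_ge0//.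
  by rewrite -ge0_integral_joint.
have i12 := integrableB measurableT i1 i2.
set h := (fun x => p x * _).
have mh : measurable_fun setT h.
  by apply: measurable_funM => //; exact: measurable_Rint_pker.
have E : ae_eq mu setT (EFin \o h) (fun x => (p x)%:E * \int[P x]_y f1 (x, y) -
    (p x)%:E * \int[P x]_y f2 (x, y))%E.
  (* Off two null sets, either the weight vanishes or both parts are finite and their difference is
     a genuine subtraction. *)
  apply: filterS2 (pint_ae _ m1 f1y) (pint_ae _ m2 f2y) => // x h1 h2 _ /=.
  rewrite /h; case: h1 => [->|h1]; first by rewrite !mul0e mul0r sube0.
  case: h2 => [->|h2]; first by rewrite !mul0e mul0r sube0.
  rewrite -muleBr ?fin_num_adde_defr// EFinM; congr (_ * _)%E.
  have E : (\int[P x]_y (F (x, y))%:E =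
      \int[P x]_y f1 (x, y) - \int[P x]_y f2 (x, y))%E by exact: integralE_slice.
  by rewrite /Rintegral E fineK// fin_numB h1 h2.
split.
  apply/integrableP; split; first exact/measurable_EFinP.
  move/integrableP : i12 => [m12]; apply: le_lt_trans.
  rewrite le_eqVlt; apply/orP; left; apply/eqP.
  apply: ae_eq_integral => //; [| |exact: ae_eq_abse].
    by apply: measurableT_comp => //; exact/measurable_EFinP.
  exact: measurableT_comp.
congr fine; rewrite [RHS]integralE !ge0_integral_joint//.
rewrite -integralB//; apply: ae_eq_integral => //; first exact/measurable_EFinP.
exact: (measurable_int mu i12).
Qed.

(** Each [P x] has total mass one, so the first marginal of the joint law is [p] times [mu]. *)
Lemma Rint_joint_fst (f : T -> R) : (forall x, 0 <= f x) -> measurable_fun setT f ->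
  intg mu (fun x => f x * p x) ->
  intg pi (fun z => f z.1) /\
  Rintegral pi setT (fun z => f z.1) = Rintegral mu setT (fun x => f x * p x).
Proof.
move=> f0 mf fi.
have mf1 : measurable_fun setT (fun z : T * T => f z.1).
  by apply: measurableT_comp => //; exact: measurable_fst.
have E : (\int[pi]_z (f z.1)%:E = \int[mu]_x (f x * p x)%:E)%E.
  rewrite (@ge0_integral_joint _ _ _ _ _ _ _ (fun z => (f z.1)%:E)) //.
  - apply: eq_integral => x _ /=; rewrite integral_cst// prob_kernel mule1.
    by rewrite -EFinM mulrC.
  - by move=> z; rewrite lee_fin.
  - exact/measurable_EFinP.
split; last by congr fine; rewrite E.
apply: intg_lty => //; rewrite E; move/integrableP : fi => [_].
by under eq_integral do rewrite /= ger0_norm ?mulr_ge0//.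
Qed.

Hypothesis rev : reversible mu P p.

Let swp (z : T * T) := (z.2, z.1).

Let mswp : measurable_fun setT swp.
Proof. by apply: measurable_fun_pair; [exact: measurable_snd|exact: measurable_fst]. Qed.

Let joint_rect A B : measurable A -> measurable B ->
  (pi (A `*` B) = \int[mu]_(x in A) ((p x)%:E * P x B))%E.
Proof.
move=> mA mB; rewrite [RHS]integral_mkcond /mjoint/= /joint.
apply: eq_integral => x _; rewrite patchE; case: ifPn => xA.
  by rewrite in_xsectionX.
by rewrite notin_xsectionX// measure0 mule0.
Qed.

(** Reversibility is this symmetry on rectangles. These are closed under intersection and generate
    the product sigma-algebra, so finite measures agreeing on them coincide. *)
Lemma joint_swap (U : set (T * T)) : measurable U ->
  pushforward pi swp U = pi U.
Proof.
pose C : set (set (T * T)) :=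
  [set A `*` B | A in measurable & B in measurable].
have CI : setI_closed C.
  move=> _ _ [X1 mX1 [X2 mX2 <-]] [Y1 mY1 [Y2 mY2 <-]].
  exists (X1 `&` Y1); first exact: measurableI.
  by exists (X2 `&` Y2); [exact: measurableI|rewrite setXI].
move=> mU; apply: (measure_unique C (fun=> setT)) => //.
- by rewrite measurable_prod_measurableType.
- by move=> _; exists setT => //; exists setT => //; rewrite setXTT.
- by apply/seteqP; split => // x _; exists 0%N.
- move=> _ [A mA [B mB <-]]; rewrite /= /pushforward.
  rewrite (_ : swp @^-1` _ = B `*` A); last first.
    by apply/seteqP; split => -[x y] [].
  by rewrite !joint_rect// rev.
- by move=> _; rewrite /= /pushforward preimage_setT mjointT ltry.
Qed.

Lemma Rint_joint_swap (F : T * T -> R) : intg pi F ->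
  intg pi (fun z => F (z.2, z.1)) /\
  Rintegral pi setT (fun z => F (z.2, z.1)) = Rintegral pi setT F.
Proof.
move=> iF; have mF := intg_measurable iF.
have E (f : T * T -> \bar R) : measurable_fun setT f -> (forall z, 0 <= f z)%E ->
    (\int[pi]_z f (swp z) = \int[pi]_z f z)%E.
  move=> mf f0; transitivity (\int[pushforward pi swp]_z f z)%E.
    by rewrite ge0_integral_pushforward.
  by apply: eq_measure_integral => U mU _; exact: joint_swap.
have mF' : measurable_fun setT (EFin \o F) by exact/measurable_EFinP.
split.
  apply/integrableP; split.
    by apply/measurable_EFinP; exact: (measurableT_comp mF mswp).
  rewrite [X in (X < _)%E](E (abse \o (EFin \o F)))//.
  - by case/integrableP : iF.
  - exact: measurableT_comp.
  - by move=> z; exact: abse_ge0.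
congr fine; rewrite [LHS]integralE [RHS]integralE.
congr (_ - _)%E.
  rewrite -[RHS](E (EFin \o F)^\+%E); first by apply: eq_integral => z _; rewrite !funeposE.
  - exact: measurable_funepos.
  - by move=> z; rewrite funeposE le_max lexx orbT.
rewrite -[RHS](E (EFin \o F)^\-%E); first by apply: eq_integral => z _; rewrite !funenegE.
- exact: measurable_funeneg.
- by move=> z; rewrite funenegE le_max lexx orbT.
Qed.

End joint_theory.

(** * Dirichlet forms *)

Lemma indic01 (T : Type) (R : realType) (A : set T) x :
  (\1_A x = 0 :> R) \/ (\1_A x = 1 :> R).
Proof. by rewrite indicE; case: (x \in A); [right|left]. Qed.

Section dirichlet.
Context d (T : measurableType d) (R : realType) (mu : {measure set T -> \bar R}).
Variables (p : T -> R) (P : R.-pker T ~> T) (dp : is_density mu p).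
Hypothesis rev : reversible mu P p.

Let mp : measurable_fun setT p. Proof. by case: dp. Qed.
Let p0 x : 0 <= p x. Proof. by case: dp => _ []. Qed.

Local Notation pi := (mjoint P dp).

Lemma L2_intg (g : T -> R) : L2 mu p g -> intg mu (fun x => g x ^+ 2 * p x).
Proof.
move=> [mg gy]; apply: intg_lty => //; first by meas.
by move=> x; rewrite mulr_ge0// sqr_ge0.
Qed.

(** By symmetry the second coordinate has the same law as the first, so square-integrability
    survives one step of the chain. *)
Lemma L2_joint (g : T -> R) : L2 mu p g ->
  intg pi (fun z => g z.1 ^+ 2) /\ intg pi (fun z => g z.2 ^+ 2).
Proof.
move=> gL; have [mg _] := gL.
have [||i1 _] := Rint_joint_fst P dp _ _ (L2_intg gL).
- by move=> x; exact: sqr_ge0.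
- by meas.
split => //; exact: (Rint_joint_swap rev i1).1.
Qed.

Lemma pker_setC x (A : set T) : measurable A ->
  fine (P x A) = 1 - fine (P x (~` A)).
Proof.
move=> mA; have mA' := measurableC mA.
have E : (P x A + P x (~` A) = 1)%E.
  rewrite -measureU// ?setICr//; rewrite setUv; exact: prob_kernel.
apply/eqP; rewrite eq_sym subr_eq -fineD ?E//; exact: finite_kernel_measure.
Qed.

Lemma measurable_restr_op (A : set T) (g : T -> R) : measurable A ->
  measurable_fun setT g -> measurable_fun setT (restr_op P A g).
Proof.
move=> mA mg; apply: measurable_funD.
  under eq_fun do rewrite Rint_indic.
  apply: (@measurable_Rint_pker _ _ _ P (fun z => \1_A z.2 * g z.2)).
  by apply: measurable_funM; apply: measurableT_comp => //; exact: measurable_indic.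
apply: measurable_funM => //; apply: measurableT_comp; first exact: fine_measurable.
exact/measurable_kernel/measurableC.
Qed.

Let mcomp1 (f : T -> R) : measurable_fun setT f ->
  measurable_fun setT (fun z : T * T => f z.1).
Proof. by move=> mf; apply: measurableT_comp => //; exact: measurable_fst. Qed.

Let mcomp2 (f : T -> R) : measurable_fun setT f ->
  measurable_fun setT (fun z : T * T => f z.2).
Proof. by move=> mf; apply: measurableT_comp => //; exact: measurable_snd. Qed.

Lemma intg_joint_sqr (A : set T) (g : T -> R) : measurable A -> L2 mu p g ->
  intg pi (fun z => \1_A z.1 * \1_A z.2 * (g z.1 - g z.2) ^+ 2).
Proof.
move=> mA gL; have [mg _] := gL; have [i1 i2] := L2_joint gL.
apply: (intg_le _ (intgD (intgZ 2 i1) (intgZ 2 i2))).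
  apply: measurable_funM; first apply: measurable_funM.
  - by apply: mcomp1; exact: measurable_indic.
  - by apply: mcomp2; exact: measurable_indic.
  - by apply/measurable_funX/measurable_funB; [exact: mcomp1|exact: mcomp2].
move=> [x y] /=; rewrite ger0_norm.
  have := sqr_ge0 (g x + g y); have := sqr_ge0 (g x); have := sqr_ge0 (g y).
  have [->|->] := @indic01 _ R A x; have [->|->] := @indic01 _ R A y; nra.
by have [->|->] := @indic01 _ R A x; have [->|->] := @indic01 _ R A y;
  rewrite ?(mul0r, mul1r, mulr0, sqr_ge0).
Qed.

(** On [A] the holding mass that the restriction adds at [x] cancels, so [g x - restr_op P A g x] is
    the integral of [g x - g y] over [y] in [A]. Averaging [g x * (g x - g y)] with its swap
    produces the square. *)
Lemma dirichlet_restrE (A : set T) (g : T -> R) : measurable A -> L2 mu p g ->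
  intg mu (fun x => g x * (g x - restr_op P A g x) * (\1_A x * p x)) /\
  Rintegral mu setT (fun x => g x * (g x - restr_op P A g x) * (\1_A x * p x)) =
  2^-1 * Rintegral pi setT (fun z => \1_A z.1 * \1_A z.2 * (g z.1 - g z.2) ^+ 2).
Proof.
move=> mA gL; have [mg _] := gL; have [i1 i2] := L2_joint gL.
have mA1 : measurable_fun setT (fun z : T * T => \1_A z.1 : R).
  by apply: mcomp1; exact: measurable_indic.
have mA2 : measurable_fun setT (fun z : T * T => \1_A z.2 : R).
  by apply: mcomp2; exact: measurable_indic.
have mg1 := mcomp1 mg; have mg2 := mcomp2 mg.
pose F (z : T * T) := \1_A z.1 * \1_A z.2 * (g z.1 * (g z.1 - g z.2)).
have iF : intg pi F.
  apply: (intg_le _ (intgD (intgZ 2 i1) (intgZ 2 i2))); first by rewrite /F; meas.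
  move=> [x y]; rewrite /F/= ler_norml.
  have := sqr_ge0 (g x + g y); have := sqr_ge0 (g x); have := sqr_ge0 (g y).
  have := sqr_ge0 (g x - g y).
  by have [->|->] := @indic01 _ R A x; have [->|->] := @indic01 _ R A y;
    move=> *; apply/andP; split; nra.
(* Follows from [|t| <= 1 + t^2]. It makes [g] integrable under [P x] for almost every [x] with
   [p x] nonzero, so that the inner integral can be split. *)
have ig2 : intg pi (fun z => g z.2).
  have i1' : intg pi (cst 1).
    apply: measurable_bounded_integrable => //.
      by rewrite mjointT ltry.
    exists 1; split; first exact: num_real.
    by move=> M M1 z _; rewrite /= normr1 ltW.
  apply: (intg_le _ (intgD i1' i2)) => // z /=; rewrite ler_norml.
  have := sqr_ge0 (g z.2 - 1); have := sqr_ge0 (g z.2 + 1); have := sqr_ge0 (g z.2).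
  by move=> *; apply/andP; split; nra.
have [iG EG] := Rint_joint iF.
have [||ih Eh] := Rint_ae (g := fun x => g x * (g x - restr_op P A g x) * (\1_A x * p x)) _ iG.
- by have mr := measurable_restr_op mA mg; meas.
- apply: filterS (joint_ae_intg ig2) => x /= -[->|ix]; first by rewrite mul0r !mulr0.
  rewrite [RHS]mulrA mulrC; congr (_ * _).
  have iA : intg (P x) (\1_A : T -> R).
    apply: measurable_bounded_integrable => //.
    - by rewrite prob_kernel ltry.
    - exists 1; split; first exact: num_real.
      move=> M M1 z _ /=; have [->|->] := @indic01 _ R A z.
        by rewrite normr0 (le_trans ler01)// ltW.
      by rewrite normr1 ltW.
  have -> : (fun y => F (x, y)) =
      (fun y => (\1_A x * g x) * (g x * \1_A y - \1_A y * g y)).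
    by apply/funext => y; rewrite /F/=; ring.
  rewrite RintegralZl//; last by apply: intgB; [exact: intgZ|exact: intg_indic].
  rewrite RintegralB//; [|exact: intgZ|exact: intg_indic].
  rewrite RintegralZl// -Rint_indic /restr_op.
  rewrite (_ : Rintegral (P x) setT \1_A = fine (P x A)); last first.
    by rewrite /Rintegral integral_indic// setIT.
  by rewrite pker_setC//; ring.
split => //; rewrite Eh EG.
have [iS ES] := Rint_joint_swap rev iF.
have -> : (fun z => \1_A z.1 * \1_A z.2 * (g z.1 - g z.2) ^+ 2) =
    (fun z => F z + F (z.2, z.1)).
  by apply/funext => z; rewrite /F/=; ring.
by rewrite RintegralD// ES; field.
Qed.

Lemma dirichlet_restr_ge0 (A : set T) (g : T -> R) : measurable A -> L2 mu p g ->
  0 <= Rintegral mu setT (fun x => g x * (g x - restr_op P A g x) * (\1_A x * p x)).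
Proof.
move=> mA gL; rewrite (dirichlet_restrE mA gL).2 mulr_ge0//.
apply: Rintegral_ge0 => z _.
by have [->|->] := @indic01 _ R A z.1; have [->|->] := @indic01 _ R A z.2;
  rewrite ?(mul0r, mul1r, mulr0, sqr_ge0).
Qed.

Lemma restr_opT (g : T -> R) : restr_op P setT g = Pop P g.
Proof.
by apply/funext => x; rewrite /restr_op setCT measure0 mulr0 addr0.
Qed.

(** By [dirichlet_restrE] it is enough to compare weights at a pair [(x, y)]: those of the cells add
    up to at most 1, the weight in the full form. *)
Lemma dirichlet_restr_sum (s : seq (set T)) (g : T -> R) :
  (forall A, A \in s -> measurable A) ->
  (forall x y, \sum_(A <- s) (\1_A x * \1_A y) <= 1 :> R) -> L2 mu p g ->
  \sum_(A <- s) Rintegral mu setT (fun x => g x * (g x - restr_op P A g x) * (\1_A x * p x))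
  <= Rintegral mu setT (fun x => g x * (g x - Pop P g x) * p x).
Proof.
move=> ms s1 gL.
rewrite (eq_big_seq (fun A => Rintegral pi setT
    (fun z => 2^-1 * (\1_A z.1 * \1_A z.2 * (g z.1 - g z.2) ^+ 2)))); last first.
  move=> A As; rewrite (dirichlet_restrE (ms _ As) gL).2 RintegralZl//.
  by apply: intg_joint_sqr => //; exact: ms.
have := (dirichlet_restrE measurableT gL).2.
rewrite restr_opT => E.
rewrite [leRHS](_ : _ = Rintegral pi setT
  (fun z => 2^-1 * (\1_setT z.1 * \1_setT z.2 * (g z.1 - g z.2) ^+ 2))); last first.
  rewrite RintegralZl//; last exact: intg_joint_sqr.
  by rewrite -E; apply: eq_Rintegral => x _; rewrite indicT mul1r.
have is_ A : A \in s -> intg pi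
    (fun z => 2^-1 * (\1_A z.1 * \1_A z.2 * (g z.1 - g z.2) ^+ 2)).
  by move=> /ms mA; apply: intgZ; exact: intg_joint_sqr.
rewrite -Rint_sum//; apply: Rint_le; first exact: intg_sum.
  by apply: intgZ; exact: intg_joint_sqr.
move=> z; rewrite -mulr_sumr -mulr_suml ler_wpM2l//.
by rewrite ler_wpM2r ?sqr_ge0// !indicT mul1r s1.
Qed.

(** Uses [(a - b)^2 <= 2 (a - c)^2 + 2 (b - c)^2] and the equality of the two marginals. With [c]
    the conditional mean it bounds the restricted gap by 2. *)
Lemma dirichlet_restr_le (A : set T) (g : T -> R) (c : R) : measurable A ->
  L2 mu p g -> L2 mu p (fun x => g x - c) ->
  Rintegral mu setT (fun x => g x * (g x - restr_op P A g x) * (\1_A x * p x)) <=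
  2 * Rintegral mu setT (fun x => (g x - c) ^+ 2 * (\1_A x * p x)).
Proof.
move=> mA gL cL; have [mg _] := gL.
rewrite (dirichlet_restrE mA gL).2.
have iA : intg mu (fun x => \1_A x * (g x - c) ^+ 2 * p x).
  by under eq_fun do rewrite -mulrA; apply: intg_indic => //; exact: L2_intg.
have mA' : measurable_fun setT (\1_A : T -> R) by exact: measurable_indic.
have [||j1 E1] := Rint_joint_fst P dp _ _ iA.
- by move=> x; rewrite mulr_ge0 ?sqr_ge0//.
- by meas.
have [j2 E2] := Rint_joint_swap rev j1.
rewrite (_ : 2 * _ = Rintegral pi setT (fun z => \1_A z.1 * (g z.1 - c) ^+ 2) +
                     Rintegral pi setT (fun z => \1_A z.2 * (g z.2 - c) ^+ 2)).
  rewrite -RintegralD// -RintegralZl//; last exact: intg_joint_sqr.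
  apply: Rint_le; [by apply: intgZ; exact: intg_joint_sqr|exact: intgD|].
  move=> z; have := sqr_ge0 (g z.1 - c + (g z.2 - c)).
  have := sqr_ge0 (g z.1 - c); have := sqr_ge0 (g z.2 - c).
  by have [->|->] := @indic01 _ R A z.1; have [->|->] := @indic01 _ R A z.2; nra.
rewrite E2 E1 mulr_natl mulr2n.
by congr (_ + _); apply: eq_Rintegral => x _; rewrite mulrA (mulrC (\1_A x)).
Qed.

End dirichlet.

(** * Partitions and restricted gaps *)

(** The empty set has infimum 0 by convention, so the bound covers it too. *)
Lemma inf_ge0 (R : realType) (S : set R) : (forall x, S x -> 0 <= x) -> 0 <= inf S.
Proof.
move=> S0; have [->|/set0P Sn] := eqVneq S set0; first by rewrite inf0.
exact: lb_le_inf.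
Qed.

Lemma inf_le_ge0 (R : realType) (S : set R) a : (forall x, S x -> 0 <= x) -> S a ->
  inf S <= a.
Proof. by move=> S0 Sa; apply: ge_inf => //; exists 0. Qed.

Lemma sqrM_ge0 (R : realType) (a b : R) : 0 <= b -> 0 <= a ^+ 2 * b.
Proof. by move=> b0; rewrite mulr_ge0// sqr_ge0. Qed.

Section partition.
Context d (T : measurableType d) (R : realType).

(** The last clause evaluates any sum over cells at a point in one rewrite; with [f] constant it
    also rules out repeated nonempty cells. *)
Definition is_part (s : seq (set T)) := forall x, exists A,
  [/\ A \in s, A x, forall B, B \in s -> B x -> B = A &
      forall f : set T -> R, \sum_(B <- s) f B * \1_B x = f A].

Lemma good_partition_seq (mu : {measure set T -> \bar R}) (p : T -> R) Pt :
  good_partition mu p Pt ->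
  exists2 s : seq (set T), (forall A, Pt A <-> A \in s) & is_part s.
Proof.
move=> [/finite_seqP[s0 sE] [_ [dis cov]]]; exists (undup s0).
  by move=> A; rewrite sE mem_undup.
move=> x; have : (\bigcup_(A in Pt) A) x by rewrite cov.
case=> A PA Ax; exists A.
have As : A \in undup s0 by rewrite mem_undup; move: PA; rewrite sE.
have U B : B \in undup s0 -> B x -> B = A.
  rewrite mem_undup => Bs Bx; apply: contrapT => BA.
  have PB : Pt B by rewrite sE.
  by have : (B `&` A) x by []; rewrite dis.
split => // f; rewrite (bigD1_seq A)//= ?undup_uniq// big1_seq ?addr0.
  by rewrite indicE mem_set// mulr1.
move=> B /andP[BA Bs]; rewrite indicE memNset ?mulr0// => Bx.
by move/eqP : BA; apply; exact: U.
Qed.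

Lemma is_part_pair (s : seq (set T)) x y : is_part s ->
  \sum_(A <- s) (\1_A x * \1_A y) <= 1 :> R.
Proof.
move=> ps; have [A [_ _ _ E]] := ps y; rewrite (E (fun B => \1_B x)).
by have [->|->] := @indic01 _ R A x.
Qed.

Variable mu : {measure set T -> \bar R}.

Lemma Rint_part (s : seq (set T)) (f : T -> R) : is_part s ->
  (forall A, A \in s -> measurable A) -> intg mu f ->
  Rintegral mu setT f = \sum_(A <- s) Rintegral mu setT (fun x => \1_A x * f x).
Proof.
move=> ps ms fi; rewrite -Rint_sum; last by move=> A /ms mA; exact: intg_indic.
apply: eq_Rintegral => x _; have [A [_ _ _ E]] := ps x.
by rewrite -mulr_suml; under eq_bigr do rewrite -[\1__ _]mul1r; rewrite E mul1r.
Qed.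

(** A weight constant on cells factors out of each cell integral, so a comparison of masses cell by
    cell lifts to weighted integrals. It serves for both [gam] and [del], with [phi] a squared
    increment of cell averages. *)
Lemma Rint_part_le (s : seq (set T)) (phi u v : T -> R) (k : R) : is_part s ->
  (forall A, A \in s -> measurable A) -> (forall x, 0 <= phi x) ->
  (forall A x y, A \in s -> A x -> A y -> phi x = phi y) ->
  intg mu u -> intg mu v ->
  (forall A, A \in s -> k * Rintegral mu A u <= Rintegral mu A v) ->
  [/\ intg mu (fun x => phi x * u x), intg mu (fun x => phi x * v x) &
  k * Rintegral mu setT (fun x => phi x * u x) <=
  Rintegral mu setT (fun x => phi x * v x)].
Proof.
move=> ps ms phi0 phic ui vi uv.
(* The common value of [phi] on [A], read at a chosen point. The default point for an empty cell is
   harmless, as that cell contributes nothing. *)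
pose c A := phi (xget point A).
have phiE x : phi x = \sum_(A <- s) c A * \1_A x.
  have [A [As Ax _ ->]] := ps x; apply: (phic A) => //.
  exact: (xgetPex point (ex_intro _ x Ax)).
have E f : intg mu f ->
    intg mu (fun x => phi x * f x) /\
    Rintegral mu setT (fun x => phi x * f x) = \sum_(A <- s) c A * Rintegral mu A f.
  move=> fi.
  have -> : (fun x => phi x * f x) = (fun x => \sum_(A <- s) c A * (\1_A x * f x)).
    apply/funext => x; rewrite phiE mulr_suml.
    by apply: eq_bigr => A _; rewrite mulrA.
  split; first by apply: intg_sum => A /ms mA; apply: intgZ; exact: intg_indic.
  rewrite Rint_sum; last by move=> A /ms mA; apply: intgZ; exact: intg_indic.
  apply: eq_big_seq => A /ms mA; rewrite RintegralZl//; last exact: intg_indic.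
  by rewrite -Rint_indic.
have [iu Eu] := E _ ui; have [iv Ev] := E _ vi; split => //.
rewrite Eu Ev mulr_sumr big_seq [leRHS]big_seq; apply: ler_sum => A As.
by rewrite mulrCA ler_wpM2l ?uv// phi0.
Qed.

End partition.

(** * Square-integrable functions under a probability density *)

Section density.
Context d (T : measurableType d) (R : realType) (mu : {measure set T -> \bar R}).
Variables (p : T -> R) (dp : is_density mu p).

Let mp : measurable_fun setT p. Proof. by case: dp. Qed.
Let p0 x : 0 <= p x. Proof. by case: dp => _ []. Qed.

Lemma density_intg : intg mu p.
Proof. by apply: intg_lty => //; case: dp => _ [_ ->]; rewrite ltry. Qed.

Lemma Rint_density : Rintegral mu setT p = 1.
Proof. by rewrite /Rintegral; case: dp => _ [_ ->]. Qed.

Lemma intg_L2 (g : T -> R) : measurable_fun setT g ->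
  intg mu (fun x => g x ^+ 2 * p x) -> L2 mu p g.
Proof.
by move=> mg gi; split => //; exact: (integrable_lty measurableT gi).
Qed.

Lemma L2B (f g : T -> R) : L2 mu p f -> L2 mu p g -> L2 mu p (fun x => f x - g x).
Proof.
move=> fL gL; have [mf _] := fL; have [mg _] := gL.
apply: intg_L2; first by meas.
apply: (intg_le _ (intgD (intgZ 2 (L2_intg dp fL)) (intgZ 2 (L2_intg dp gL)))).
  by meas.
move=> x; rewrite ger0_norm ?sqrM_ge0//.
rewrite !mulrA -mulrDl ler_wpM2r//.
by have := sqr_ge0 (f x + g x); nra.
Qed.

Lemma L2_bounded (f : T -> R) (M : R) : measurable_fun setT f ->
  (forall x, `|f x| <= M) -> L2 mu p f.
Proof.
move=> mf fM; apply: intg_L2 => //.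
apply: (intg_le _ (intgZ (M ^+ 2) density_intg)); first by meas.
move=> x; rewrite ger0_norm ?sqrM_ge0// ler_wpM2r//.
by rewrite -real_normK ?num_real// lerXn2r ?nnegrE// (le_trans _ (fM x)).
Qed.

Lemma L2_cst (c : R) : L2 mu p (cst c).
Proof. exact: (@L2_bounded _ `|c|). Qed.

Lemma L2_intg1 (g : T -> R) : L2 mu p g -> intg mu (fun x => g x * p x).
Proof.
move=> gL; have [mg _] := gL.
apply: (intg_le _ (intgD (L2_intg dp gL) density_intg)); first by meas.
move=> x; rewrite normrM (ger0_norm (p0 x)) -[X in _ + X]mul1r -mulrDl ler_wpM2r//.
rewrite ler_norml; have := sqr_ge0 (g x - 1); have := sqr_ge0 (g x + 1).
by move=> ? ?; apply/andP; split; nra.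
Qed.

End density.

(** * Poincare inequalities on cells from restricted gaps *)

Section gap.
Context d (T : measurableType d) (R : realType) (mu : {measure set T -> \bar R}).
Variables (p : T -> R) (P : R.-pker T ~> T) (dp : is_density mu p).
Hypothesis rev : reversible mu P p.

Let mp : measurable_fun setT p. Proof. by case: dp. Qed.
Let p0 x : 0 <= p x. Proof. by case: dp => _ []. Qed.

Section cell.
Variable A : set T.
Hypotheses (mA : measurable A) (pA : 0 < pmass mu p A).

Let m := pmass mu p A.
Let q := cond_density mu p A.

Let mI : measurable_fun setT (\1_A : T -> R).
Proof. exact: measurable_indic. Qed.

Let qE x : q x = m^-1 * (\1_A x * p x).
Proof. by rewrite /q /cond_density mulrC. Qed.

Lemma L2_cond (g : T -> R) : L2 mu p g -> L2 mu q g.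
Proof.
move=> gL; have [mg _] := gL; split => //.
have : intg mu (fun x => m^-1 * (\1_A x * (g x ^+ 2 * p x))).
  by apply/intgZ/intg_indic => //; exact: L2_intg.
move=> /(integrable_lty measurableT); apply: le_lt_trans.
rewrite le_eqVlt; apply/orP; left; apply/eqP/eq_integral => x _ /=.
by congr EFin; rewrite qE; ring.
Qed.

(** Membership in L2 of [q] says nothing about [g] off [A]; cutting [g] off there gives a function
    in L2 of [p], to which the results on the whole chain apply. *)
Let L2_cond_restr (g : T -> R) : L2 mu q g -> L2 mu p (fun x => \1_A x * g x).
Proof.
move=> [mg gy]; apply: intg_L2; first by meas.
have gi : intg mu (fun x => g x ^+ 2 * q x).
  apply: intg_lty => //.
    by under eq_fun do rewrite qE; meas.
  by move=> x; rewrite qE sqrM_ge0// !mulr_ge0 ?invr_ge0// ltW.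
have := intgZ m gi; congr (_ .-integrable _ _); apply/funext => x /=; congr EFin.
rewrite qE; have m0 : m != 0 by rewrite gt_eqF.
by have [->|->] := @indic01 _ R A x; rewrite ?mul0r ?mulr0 ?expr0n/= ?mul0r//; field.
Qed.

Let D (g : T -> R) :=
  Rintegral mu setT (fun x => g x * (g x - restr_op P A g x) * (\1_A x * p x)).

Let restr_op_indic (g : T -> R) x : A x ->
  restr_op P A (fun x => \1_A x * g x) x = restr_op P A g x.
Proof.
move=> Ax; rewrite /restr_op indicE mem_set// mul1r; congr (_ + _).
by apply: eq_Rintegral => y yA; rewrite indicE yA mul1r.
Qed.

Let cond_dirichlet (g : T -> R) : L2 mu q g ->
  Dirichlet mu q (restr_op P A) g = m^-1 * D (fun x => \1_A x * g x).
Proof.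
move=> gL; rewrite /D -RintegralZl//; last first.
  exact: (dirichlet_restrE dp rev mA (L2_cond_restr gL)).1.
apply: eq_Rintegral => x _; rewrite qE.
have [xA|xA] := boolP (x \in A); last by rewrite indicE (negbTE xA) !mul0r !mulr0.
by rewrite restr_op_indic ?indicE ?xA ?mul1r; [ring|rewrite inE in xA].
Qed.

Let cond_var (g : T -> R) : L2 mu q g ->
  Var mu q g =
  m^-1 * Rintegral mu setT (fun x => (\1_A x * g x - mean mu q g) ^+ 2 * (\1_A x * p x)).
Proof.
move=> gL; have hL := L2B dp (L2_cond_restr gL) (L2_cst dp (mean mu q g)).
rewrite -RintegralZl//; last first.
  have := intg_indic mA (L2_intg dp hL); congr (_ .-integrable _ _).
  by apply/funext => x /=; rewrite mulrCA.
apply: eq_Rintegral => x _; rewrite qE.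
by have [->|->] := @indic01 _ R A x; ring.
Qed.

Let gap_elt_ge0 r : [set Dirichlet mu q (restr_op P A) g / Var mu q g |
    g in [set g | L2 mu q g /\ 0 < Var mu q g]] r -> 0 <= r.
Proof.
move=> [g [gL gV] <-]; rewrite divr_ge0 ?(ltW gV)// cond_dirichlet//.
rewrite mulr_ge0 ?invr_ge0 ?(ltW pA)//.
exact: (dirichlet_restr_ge0 dp rev mA (L2_cond_restr gL)).
Qed.

Lemma Gap_restr_ge0 : 0 <= Gap_restr mu P p A.
Proof. exact: inf_ge0. Qed.

(** Every quotient in the infimum is at most 2, by [dirichlet_restr_le] centred at the conditional
    mean; with no admissible function the gap is 0. This later replaces [gmin] by a constant in
    front of the swap terms. *)
Lemma Gap_restr_le2 : Gap_restr mu P p A <= 2.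
Proof.
rewrite /Gap_restr /gap_of; set S := (X in inf X).
have [->|/set0P[r Sr]] := eqVneq S set0; first by rewrite inf0.
apply: (le_trans (inf_le_ge0 gap_elt_ge0 Sr)).
case: Sr => g [gL gV] <-; rewrite ler_pdivrMr// cond_dirichlet// cond_var//.
rewrite mulrCA ler_wpM2l ?invr_ge0 ?(ltW pA)//.
have hL := L2_cond_restr gL.
exact: (dirichlet_restr_le dp rev mA hL (L2B dp hL (L2_cst dp _))).
Qed.

(** The normalising factor [m^-1] of the conditional density sits on both sides and cancels, which
    leaves an inequality that can be summed over cells. *)
Lemma Gap_restr_var (g : T -> R) : L2 mu p g ->
  Gap_restr mu P p A *
    Rintegral mu setT (fun x => \1_A x * ((g x - mean mu q g) ^+ 2 * p x)) <=
  Rintegral mu setT (fun x => g x * (g x - restr_op P A g x) * (\1_A x * p x)).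
Proof.
move=> gL; have qL := L2_cond gL.
have m0 : 0 < m^-1 by rewrite invr_gt0.
have VE : Var mu q g = m^-1 *
    Rintegral mu setT (fun x => \1_A x * ((g x - mean mu q g) ^+ 2 * p x)).
  rewrite cond_var//; congr (_ * _); apply: eq_Rintegral => x _.
  by have [->|->] := @indic01 _ R A x; ring.
have DE : Dirichlet mu q (restr_op P A) g = m^-1 * D g.
  rewrite cond_dirichlet//; congr (_ * _); apply: eq_Rintegral => x _.
  have [xA|xA] := boolP (x \in A); last by rewrite indicE (negbTE xA) !mul0r !mulr0.
  by rewrite restr_op_indic ?indicE ?xA ?mul1r//; rewrite inE in xA.
rewrite -(ler_pM2l m0) mulrCA -VE -[leRHS]DE.
(* Without positive variance [g] is not admissible in the infimum; then the left side is nonpositive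
   and the Dirichlet form nonnegative. *)
have [V0|V0] := ltP 0 (Var mu q g).
  rewrite -ler_pdivlMr//; apply: inf_le_ge0 => //.
  by exists g.
apply: (@le_trans _ _ 0).
  by rewrite mulr_ge0_le0// Gap_restr_ge0.
by rewrite DE mulr_ge0 ?(ltW m0)//; exact: (dirichlet_restr_ge0 dp rev mA gL).
Qed.

End cell.

(** The conditional expectation of [g] given the cells, written as a step function so that it is
    defined everywhere and bounded. *)
Definition cell_avg (s : seq (set T)) (g : T -> R) (x : T) : R :=
  \sum_(A <- s) mean mu (cond_density mu p A) g * \1_A x.

Lemma cell_avg_const (s : seq (set T)) (g : T -> R) A x y : is_part R s ->
  A \in s -> A x -> A y -> cell_avg s g x = cell_avg s g y.
Proof.
move=> ps As Ax Ay; rewrite /cell_avg.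
have [B [_ _ UB ->]] := ps x; have [B' [_ _ UB' ->]] := ps y.
by rewrite -(UB A As Ax) -(UB' A As Ay).
Qed.

(** [q] is separate from the averaging density because averages of one level are integrated against
    densities of other levels. *)
Lemma L2_cell_avg (q : T -> R) (s : seq (set T)) (g : T -> R) : is_density mu q ->
  (forall A, A \in s -> measurable A) -> L2 mu q (cell_avg s g).
Proof.
move=> dq ms; have mc : measurable_fun setT (cell_avg s g).
  rewrite /cell_avg; elim: s ms => [|A s ih] ms.
    by under eq_fun do rewrite big_nil; exact: measurable_cst.
  under eq_fun do rewrite big_cons; apply: measurable_funD.
    apply: measurable_funM => //; apply: measurable_indic.
    by apply: ms; rewrite mem_head.
  by apply: ih => B Bs; apply: ms; rewrite inE Bs orbT.
apply: (@L2_bounded _ _ _ _ _ dq _ (\sum_(A <- s) `|mean mu (cond_density mu p A) g|)) => // x.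
apply: (le_trans (ler_norm_sum _ _ _)); apply: ler_sum => A _.
rewrite normrM; have [->|->] := @indic01 _ R A x.
  by rewrite normr0 mulr0.
by rewrite normr1 mulr1.
Qed.

Lemma local_gap (s : seq (set T)) (g : T -> R) (k : R) : is_part R s ->
  (forall A, A \in s -> measurable A /\ 0 < pmass mu p A) ->
  (forall A, A \in s -> k <= Gap_restr mu P p A) -> L2 mu p g ->
  k * Rintegral mu setT (fun x => (g x - cell_avg s g x) ^+ 2 * p x) <=
  Rintegral mu setT (fun x => g x * (g x - Pop P g x) * p x).
Proof.
move=> ps hs ks gL.
have ms A : A \in s -> measurable A by move=> /hs[].
apply: le_trans (dirichlet_restr_sum dp rev ms _ gL); last first.
  by move=> x y; exact: is_part_pair.
rewrite (Rint_part ps ms); last exact: (L2_intg dp (L2B dp gL (L2_cell_avg g dp ms))).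
rewrite mulr_sumr big_seq [leRHS]big_seq; apply: ler_sum => A As.
have [mA pA] := hs _ As.
apply: le_trans (Gap_restr_var mA pA gL).
rewrite [X in _ * X <= _](_ : _ = Rintegral mu setT (fun x => \1_A x *
    ((g x - mean mu (cond_density mu p A) g) ^+ 2 * p x))); last first.
  apply: eq_Rintegral => x _; rewrite indicE; case: (boolP (x \in A)) => xA; last first.
    by rewrite !mul0r.
  rewrite !mul1r; congr ((_ - _) ^+ 2 * _); rewrite /cell_avg.
  by have [B [_ _ UB ->]] := ps x; rewrite -(UB A)//; rewrite inE in xA.
rewrite ler_wpM2r ?ks//; apply: Rintegral_ge0 => x _.
by rewrite mulr_ge0// sqrM_ge0.
Qed.

End gap.

(** * The simulated tempering chain *)

(** Cauchy-Schwarz against the constant sequence. With [S] the sum of the first [M] terms and [a]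
    the next one, the induction step reduces to [(S - M a)^2 >= 0]; the single-term case is split
    off to have [M > 0]. *)
Lemma sqr_sum_le (R : realType) (a : nat -> R) m :
  (\sum_(j < m) a j) ^+ 2 <= m%:R * \sum_(j < m) a j ^+ 2.
Proof.
elim: m => [|m ih]; first by rewrite !big_ord0 expr0n mul0r.
rewrite !big_ord_recr/=; case: m ih => [|m] ih.
  by rewrite !big_ord0 !add0r mul1r.
set S := \sum_(j < m.+1) a j in ih *; set Q := \sum_(j < m.+1) a j ^+ 2 in ih *.
set M : R := m.+1%:R in ih *.
have M0 : 0 < M by rewrite ltr0n.
have -> : m.+2%:R = M + 1 by rewrite -natr1.
suff : 2 * S * a m.+1 <= Q + M * a m.+1 ^+ 2 by nra.
rewrite -(ler_pM2l M0); have := sqr_ge0 (S - M * a m.+1); nra.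
Qed.

Section tempering.
Context d (T : measurableType d) (R : realType) (mu : {measure set T -> \bar R}).
Variables (n : nat) (Ps : 'I_n.+1 -> R.-pker T ~> T) (p : 'I_n.+1 -> T -> R)
  (r : 'I_n.+1 -> R).
Hypotheses (dp : forall i, is_density mu (p i))
  (rev : forall i, reversible mu (Ps i) (p i))
  (r0 : forall i, 0 < r i) (r1 : \sum_(i < n.+1) r i = 1).
Variable g : 'I_n.+1 -> T -> R.
Hypothesis gL : L2_st mu p g.

Let mp i : measurable_fun setT (p i). Proof. by case: (dp i). Qed.
Let p0 i x : 0 <= p i x. Proof. by case: (dp i) => _ []. Qed.
Let mg i : measurable_fun setT (g i). Proof. by case: (gL i). Qed.

Let w i x := r i * p i x.
Let mn k k' x := Num.min (w k x) (w k' x).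

Let w0 i x : 0 <= w i x. Proof. by rewrite mulr_ge0// ltW. Qed.
Let mn0 k k' x : 0 <= mn k k' x. Proof. by rewrite le_min !w0. Qed.
Let mnl k k' x : mn k k' x <= w k x. Proof. by rewrite ge_min lexx. Qed.
Let mnr k k' x : mn k k' x <= w k' x. Proof. by rewrite ge_min lexx orbT. Qed.
Let mmn k k' : measurable_fun setT (mn k k').
Proof. by apply: measurable_minr; rewrite /w; meas. Qed.

(** Detailed balance of the level moves: the flow between two levels is symmetric. The default
    acceptance 1 at weight zero is harmless, as the flow is 0 there. *)
Let acceptE k k' x : accept p r k k' x * w k x = mn k k' x.
Proof.
rewrite /accept /mn -/(w k x) -/(w k' x); case: ifPn => [/eqP wk0|wk0].
  by rewrite wk0 mulr0 min_l.
by rewrite minr_pMl// mul1r divfK// minC.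
Qed.

Let wL2 i : intg mu (fun x => w i x * g i x ^+ 2).
Proof.
have := intgZ (r i) (L2_intg (dp i) (gL i)); congr (_ .-integrable _ _).
by apply/funext => x /=; rewrite /w; congr EFin; ring.
Qed.

Let cross k k' : intg mu (fun x => mn k k' x * (g k x * (g k x - g k' x))).
Proof.
apply: (intg_le _ (intgD (intgZ 2 (wL2 k)) (intgZ 2 (wL2 k')))).
  by have mg1 := mg k; have mg2 := mg k'; have mm := mmn k k'; meas.
move=> x; rewrite normrM (ger0_norm (mn0 _ _ _)).
apply: (@le_trans _ _ (mn k k' x * (2 * g k x ^+ 2 + 2 * g k' x ^+ 2))).
  rewrite ler_wpM2l// ler_norml.
  have := sqr_ge0 (g k x + g k' x); have := sqr_ge0 (g k x - g k' x).
  have := sqr_ge0 (g k x); have := sqr_ge0 (g k' x).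
  by move=> *; apply/andP; split; nra.
rewrite mulrDr lerD// mulrCA ler_wpM2l// ler_wpM2r ?sqr_ge0//.
Qed.

Let sqr_intg k k' : intg mu (fun x => mn k k' x * (g k x - g k' x) ^+ 2).
Proof.
have := intgD (cross k k') (cross k' k); congr (_ .-integrable _ _).
by apply/funext => x /=; congr EFin; rewrite [mn k' k x]minC; rewrite /mn; ring.
Qed.

Definition swap_form k k' :=
  Rintegral mu setT (fun x => Num.min (r k * p k x) (r k' * p k' x) * (g k x - g k' x) ^+ 2).

Lemma swap_form_ge0 k k' : 0 <= swap_form k k'.
Proof. by apply: Rintegral_ge0 => x _; rewrite mulr_ge0 ?sqr_ge0//; exact: mn0. Qed.

Let swap_formC k k' : swap_form k k' = swap_form k' k.
Proof. by apply: eq_Rintegral => x _; rewrite minC; ring. Qed.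

(** A level move contributes one half for its type and [1/L] for the proposal, times the flow
    against [g k x - g k' x]. Symmetrising over ordered pairs gives the square and a further one
    half, hence [4^-1]. *)
Lemma Dirichlet_stE : Dirichlet_st mu Ps p r g =
  2^-1 * (\sum_(k < n.+1) r k *
    Rintegral mu setT (fun x => g k x * (g k x - Pop (Ps k) (g k) x) * p k x)) +
  4^-1 * (n.+1%:R^-1 * \sum_(k < n.+1) \sum_(k' < n.+1) swap_form k k').
Proof.
have [N NE] : exists N : R, N = n.+1%:R by exists n.+1%:R.
have N0 : N != 0 by rewrite NE pnatr_eq0.
rewrite -NE.
pose X k k' := Rintegral mu setT (fun x => mn k k' x * (g k x * (g k x - g k' x))).
have XE : \sum_(k < n.+1) \sum_(k' < n.+1) swap_form k k' =
    2 * \sum_(k < n.+1) \sum_(k' < n.+1) X k k'.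
  have -> : \sum_(k < n.+1) \sum_(k' < n.+1) swap_form k k' =
      \sum_(k < n.+1) \sum_(k' < n.+1) (X k k' + X k' k).
    apply: eq_bigr => k _; apply: eq_bigr => k' _.
    rewrite /X -RintegralD//; apply: eq_Rintegral => x _.
    by rewrite [mn k' k x]minC /mn /w; ring.
  under eq_bigr do rewrite big_split/=.
  by rewrite big_split/= [X in _ + X]exchange_big/= mulr_natl mulr2n.
rewrite XE /Dirichlet_st /ip_st !mulr_sumr -big_split/=; apply: eq_bigr => k _.
have iD : intg mu (fun x => g k x * (g k x - Pop (Ps k) (g k) x) * p k x).
  have := (dirichlet_restrE (dp k) (rev k) measurableT (gL k)).1.
  rewrite restr_opT; congr (_ .-integrable _ _).
  by apply/funext => x /=; rewrite indicT mul1r.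
have iX : intg mu (fun x => \sum_(k' < n.+1) mn k k' x * (g k x * (g k x - g k' x))).
  by apply: intg_sum => k' _; exact: cross.
have E : (fun x => g k x * (g k x - st_op Ps p r g k x) * p k x) =
  (fun x => 2^-1 * (g k x * (g k x - Pop (Ps k) (g k) x) * p k x) +
    (2^-1 * N^-1 * (r k)^-1) *
      \sum_(k' < n.+1) mn k k' x * (g k x * (g k x - g k' x))).
  apply/funext => x; rewrite /st_op -NE.
  have rk : r k != 0 by rewrite gt_eqF.
  have -> : \sum_(k' < n.+1) mn k k' x * (g k x * (g k x - g k' x)) =
      r k * p k x * g k x * \sum_(k' < n.+1) accept p r k k' x * (g k x - g k' x).
    rewrite mulr_sumr; apply: eq_bigr => k' _; rewrite -acceptE /w; ring.
  have -> : \sum_(k' < n.+1) (accept p r k k' x * g k' x + (1 - accept p r k k' x) * g k x) =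
      N * g k x - \sum_(k' < n.+1) accept p r k k' x * (g k x - g k' x).
    apply/eqP; rewrite eq_sym subr_eq -big_split/=.
    rewrite (eq_bigr (fun=> g k x)); last by move=> k' _; ring.
    by rewrite sumr_const card_ord NE mulr_natl.
  by field; rewrite ?N0 ?rk.
rewrite E RintegralD//; [|exact: intgZ|exact: intgZ].
rewrite !RintegralZl// Rint_sum; last by move=> k' _; exact: cross.
rewrite -/(X k _).
have rk : r k != 0 by rewrite gt_eqF.
under [in RHS]eq_bigr do rewrite -/(X k _).
by field; rewrite ?N0 ?rk.
Qed.

Lemma Dirichlet_st_ge0 : 0 <= Dirichlet_st mu Ps p r g.
Proof.
rewrite Dirichlet_stE addr_ge0// mulr_ge0 ?invr_ge0//.
  apply: sumr_ge0 => k _; rewrite mulr_ge0 ?(ltW (r0 k))//.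
  have := dirichlet_restr_ge0 (dp k) (rev k) measurableT (gL k).
  by rewrite restr_opT; under eq_Rintegral do rewrite indicT mul1r.
rewrite mulr_ge0 ?invr_ge0//.
by do 2 (apply: sumr_ge0 => ? _); exact: swap_form_ge0.
Qed.

(** Each adjacent pair occurs in both orders in the double sum, and the remaining terms are
    nonnegative. *)
Lemma swap_form_adj :
  2 * \sum_(j < n) swap_form (inord j.+1) (inord j) <=
  \sum_(k < n.+1) \sum_(k' < n.+1) swap_form k k'.
Proof.
(* Marks the pairs with [k] just above [k']; [c k k'] and [c k' k] are never both 1, so together
   they weigh at most 1. *)
pose c (k k' : 'I_n.+1) : R := (k == k'.+1 :> nat)%:R.
have c0 k k' : 0 <= c k k' * swap_form k k' by rewrite mulr_ge0// swap_form_ge0.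
have adj : \sum_(j < n) swap_form (inord j.+1) (inord j) <=
    \sum_(k < n.+1) \sum_(k' < n.+1) c k k' * swap_form k k'.
  rewrite exchange_big/= big_ord_recr/= -[leLHS]addr0 lerD ?sumr_ge0//.
  apply: ler_sum => j _.
  have jn : (j.+1 < n.+1)%N by rewrite ltnS.
  have -> : inord j = widen_ord (leqnSn n) j.
    by apply: val_inj; rewrite /= inordK// ltnW.
  rewrite (bigD1 (inord j.+1))//= /c inordK// eqxx mul1r lerDl.
  by apply: sumr_ge0 => k _; exact: c0.
apply: (@le_trans _ _ (\sum_(k < n.+1) \sum_(k' < n.+1)
    (c k k' * swap_form k k' + c k' k * swap_form k' k))).
  under [leRHS]eq_bigr do rewrite big_split/=.
  rewrite big_split/= [X in _ <= _ + X]exchange_big/= mulr_natl mulr2n.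
  exact: lerD.
apply: ler_sum => k _; apply: ler_sum => k' _.
rewrite (swap_formC k' k) -mulrDl ler_piMl ?swap_form_ge0// /c -natrD.
rewrite lern1; case: eqP => [->|_]; last by case: eqP.
by rewrite ltn_eqF// ltnS leqW.
Qed.

(** The second moment around [c] is the variance plus the squared bias. The free centre lets the
    constant average of level 0 be used. *)
Lemma Var_st_le (c : R) :
  Var_st mu p r g <= \sum_(i < n.+1) r i * Rintegral mu setT (fun x => (g i x - c) ^+ 2 * p i x).
Proof.
set m := mean_st mu p r g.
have iv i b : intg mu (fun x => (g i x - b) ^+ 2 * p i x).
  exact: (L2_intg (dp i) (L2B (dp i) (gL i) (L2_cst (dp i) b))).
have i1 i : intg mu (fun x => g i x * p i x) by exact: L2_intg1.
have ip_ i : intg mu (p i) by exact: density_intg.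
have E i : Rintegral mu setT (fun x => (g i x - c) ^+ 2 * p i x) =
    Rintegral mu setT (fun x => (g i x - m) ^+ 2 * p i x) +
    (2 * (m - c) * (Rintegral mu setT (fun x => g i x * p i x) - m) + (m - c) ^+ 2).
  have -> : (fun x => (g i x - c) ^+ 2 * p i x) = (fun x => (g i x - m) ^+ 2 * p i x +
      ((2 * (m - c)) * (g i x * p i x) + ((m - c) ^+ 2 - 2 * (m - c) * m) * p i x)).
    by apply/funext => x; ring.
  rewrite RintegralD//; last by apply: intgD; exact: intgZ.
  rewrite RintegralD//; [|exact: intgZ|exact: intgZ].
  rewrite !RintegralZl// (Rint_density (dp i)) mulr1; congr (_ + _).
  by rewrite [in RHS]mulrBr addrA [RHS]addrAC.
under [leRHS]eq_bigr do rewrite E mulrDr.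
rewrite big_split/= -[leLHS]addr0 lerD//.
(* The cross term averages to zero under [r] because [b] is the mean of [J]; only the squared bias,
   in the role of [q], remains. *)
have K (a q b : R) (J : 'I_n.+1 -> R) : b = \sum_(i < n.+1) r i * J i ->
    \sum_(i < n.+1) r i * (a * (J i - b) + q) = q.
  move=> bE; rewrite (eq_bigr (fun i => a * (r i * J i) + (q - a * b) * r i)).
    by rewrite big_split/= -!mulr_sumr r1 -bE; ring.
  by move=> i _; ring.
by rewrite K// sqr_ge0.
Qed.

(** * Comparison of levels along the nested partitions *)

Variables (s : 'I_n.+1 -> seq (set T)) (gam del rr gmin : R).
Hypotheses (ps : forall i, is_part R (s i))
  (hs : forall i A, A \in s i -> measurable A /\ 0 < pmass mu (p i) A)
  (s0 : setT \in s ord0)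
  (ref : forall (j : 'I_n) A, A \in s (inord j.+1) ->
    exists2 B, B \in s (inord j) & A `<=` B)
  (hgam : forall (i1 i2 : 'I_n.+1) A, (i1 <= i2)%N -> A \in s i1 ->
    gam * pmass mu (p i2) A <= pmass mu (p i1) A)
  (hdel : forall (j : 'I_n) A, A \in s (inord j.+1) ->
    del * pmass mu (p (inord j.+1)) A <=
    Rintegral mu A (fun x => Num.min (p (inord j) x) (p (inord j.+1) x)))
  (hrr : forall i, rr <= n.+1%:R * r i)
  (hgmin : forall i A, A \in s i -> gmin <= Gap_restr mu (Ps i) (p i) A)
  (gam01 : 0 <= gam <= 1) (del01 : 0 <= del <= 1) (rr01 : 0 <= rr <= 1)
  (gmin02 : 0 <= gmin <= 2).

Let ms i A : A \in s i -> measurable A. Proof. by move=> /hs[]. Qed.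
Let gb i := cell_avg mu (p i) (s i) (g i).
Let V i := Rintegral mu setT (fun x => (g i x - gb i x) ^+ 2 * p i x).
Let V0 i : 0 <= V i.
Proof. by apply: Rintegral_ge0 => x _; exact: sqrM_ge0. Qed.
Let gbL i k : L2 mu (p i) (gb k).
Proof. exact: (L2_cell_avg _ _ (dp i) (@ms k)). Qed.

Let mp2 (j : 'I_n) x := Num.min (p (inord j) x) (p (inord j.+1) x).
Let Q (j : 'I_n) := Rintegral mu setT
  (fun x => mp2 j x * (g (inord j.+1) x - g (inord j) x) ^+ 2).
Let dl (j : 'I_n) x := gb (inord j.+1) x - gb (inord j) x.

Let mp2_0 j x : 0 <= mp2 j x. Proof. by rewrite le_min !p0. Qed.
Let mp2l j x : mp2 j x <= p (inord j) x. Proof. by rewrite ge_min lexx. Qed.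
Let mp2r j x : mp2 j x <= p (inord j.+1) x. Proof. by rewrite ge_min lexx orbT. Qed.
Let mmp2 j : measurable_fun setT (mp2 j).
Proof. exact: measurable_minr. Qed.
Let imp2 j : intg mu (mp2 j).
Proof.
apply: (intg_le (mmp2 j) (density_intg (dp (inord j)))) => x.
by rewrite ger0_norm.
Qed.

Let dl_const (j : 'I_n) (A : set T) (x y : T) : A \in s (inord j.+1) -> A x -> A y -> dl j x = dl j y.
Proof.
move=> As Ax Ay; rewrite /dl /gb (cell_avg_const _ _ _ (ps _) As Ax Ay).
have [B Bs AB] := ref As.
by rewrite (cell_avg_const _ _ _ (ps _) Bs (AB _ Ax) (AB _ Ay)).
Qed.

Let gapV i : gmin * V i <=
  Rintegral mu setT (fun x => g i x * (g i x - Pop (Ps i) (g i) x) * p i x).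
Proof.
apply: (local_gap (dp i) (rev i) (ps i) (@hs i) _ (gL i)) => A As.
exact: hgmin.
Qed.

Let sqr3 (a b c : R) : (a + b + c) ^+ 2 <= 3 * (a ^+ 2 + b ^+ 2 + c ^+ 2).
Proof.
have := sqr_ge0 (a - b); have := sqr_ge0 (a - c); have := sqr_ge0 (b - c); nra.
Qed.

Let Q_intg (j : 'I_n) : intg mu (fun x => mp2 j x * (g (inord j.+1) x - g (inord j) x) ^+ 2).
Proof.
apply: (intg_le _ (intgD (intgZ 2 (L2_intg (dp (inord j.+1)) (gL (inord j.+1))))
  (intgZ 2 (L2_intg (dp (inord j)) (gL (inord j)))))).
  by have m1 := mmp2 j; have m2 := mg (inord j.+1); have m3 := mg (inord j); meas.
move=> x; rewrite ger0_norm; last by apply: mulr_ge0 => //; exact: sqr_ge0.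
set a := g _ x; set b := g _ x.
apply: (@le_trans _ _ (mp2 j x * (2 * a ^+ 2 + 2 * b ^+ 2))).
  by rewrite ler_wpM2l//; have := sqr_ge0 (a + b); nra.
by rewrite mulrDr lerD// mulrCA ler_wpM2l// mulrC ler_wpM2l ?sqr_ge0.
Qed.

(* From gb_j to gb_{j-1} through g_j and g_{j-1}. *)
Let step (j : 'I_n) : del * Rintegral mu setT (fun x => dl j x ^+ 2 * p (inord j.+1) x)
  <= 3 * (V (inord j.+1) + V (inord j) + Q j).
Proof.
(* [del] replaces the density of level [j.+1] by the overlap [mp2 j], which lies below both
   densities and can be charged to either level. *)
have [_ idl] := Rint_part_le (ps (inord j.+1)) (@ms _)
  (fun x => sqr_ge0 (dl j x)) (fun A x y As Ax Ay => congr1 (fun z => z ^+ 2)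
    (dl_const As Ax Ay)) (density_intg (dp (inord j.+1))) (imp2 j) (@hdel j).
move/le_trans; apply.
have i1 := L2_intg (dp (inord j.+1)) (L2B (dp _) (gL (inord j.+1)) (gbL _ (inord j.+1))).
have i2 := L2_intg (dp (inord j)) (L2B (dp _) (gL (inord j)) (gbL _ (inord j))).
rewrite /V /Q -RintegralD// -RintegralD//; last exact: intgD.
rewrite -RintegralZl//; last by do 2 apply: intgD => //.
apply: Rint_le => //; first by apply/intgZ/intgD => //; exact: intgD.
move=> x; set a := g _ x; set b := gb _ x; set a' := g _ x; set b' := gb _ x.
apply: (@le_trans _ _ (3 * ((a - b) ^+ 2 + (a' - b') ^+ 2 + (a - a') ^+ 2) * mp2 j x)).
  rewrite ler_wpM2r//.
  have := sqr3 (a - b) (- (a' - b')) (- (a - a')).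
  rewrite !sqrrN; apply: le_trans; rewrite le_eqVlt; apply/orP; left; apply/eqP.
  by rewrite /dl -/b -/b'; ring.
(* The first square is charged to level [j.+1], the second to level [j]; the third already has the
   form of [Q j]. *)
rewrite -mulrA ler_wpM2l// !mulrDl lerD//; last by rewrite mulrC.
by rewrite lerD// ler_wpM2l ?sqr_ge0.
Qed.

(** The cost of all steps together. Charging every level the whole sum makes the bound in [level]
    independent of [i]. *)
Let Ntot := \sum_(j < n) (V (inord j.+1) + V (inord j) + Q j).

Let gb0 x y : gb ord0 x = gb ord0 y.
Proof. exact: (cell_avg_const _ _ _ (ps _) s0). Qed.

(** The increments telescope from level 0, where the average is constant. The factor [n], the number
    of steps, comes from Cauchy-Schwarz and the 3 from [step]. *)
Let level (i : 'I_n.+1) :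
  gam * del * Rintegral mu setT (fun x => (gb i x - gb ord0 point) ^+ 2 * p i x) <=
  3 * n%:R * Ntot.
Proof.
have idl (j : 'I_n) : intg mu (fun x => dl j x ^+ 2 * p i x).
  exact: (L2_intg (dp i) (L2B (dp i) (gbL _ _) (gbL _ _))).
(* This indicator keeps the range of summation fixed at [n] while only the steps up to level [i]
   count. *)
pose b (j : 'I_n) : R := (j < i)%N%:R.
have dec x : (gb i x - gb ord0 point) ^+ 2 <= n%:R * \sum_(j < n) b j * dl j x ^+ 2.
  pose a j := if (j < i)%N then gb (inord j.+1) x - gb (inord j) x else 0.
  have -> : gb i x - gb ord0 point = \sum_(j < n) a j.
    rewrite (gb0 point x).
    have -> : \sum_(j < n) a j = \sum_(0 <= j < n) a j by rewrite big_mkord.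
    have iN : (i <= n)%N by rewrite -ltnS.
    rewrite (big_cat_nat (n := i))//= [X in _ = _ + X]big1_seq ?addr0; last first.
      move=> j /=; rewrite mem_index_iota => /andP[ij _].
      by rewrite /a ltnNge ij.
    rewrite (eq_big_nat _ _ (F2 := fun j => gb (inord j.+1) x - gb (inord j) x)); last first.
      by move=> j /andP[_ ji]; rewrite /a ji.
    rewrite [RHS](telescope_sumr (fun j => gb (inord j) x) (leq0n i)).
    have -> : inord i = i by apply: val_inj; rewrite /= inordK.
    by have -> : inord 0 = ord0 :> 'I_n.+1 by apply: val_inj; rewrite /= inordK.
  apply: (le_trans (sqr_sum_le a n)); rewrite ler_wpM2l//; apply: ler_sum => j _.
  by rewrite /a /b /dl; case: ifP => _; rewrite ?mul1r// expr0n/= mul0r.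
have gd : 0 <= gam * del by case/andP: gam01 => ? _; case/andP: del01 => ? _; rewrite mulr_ge0.
have ib : intg mu (fun x => \sum_(j < n) b j * (dl j x ^+ 2 * p i x)).
  by apply: intg_sum => j _; exact: intgZ.
apply: (@le_trans _ _ (gam * del * (n%:R *
    \sum_(j < n) b j * Rintegral mu setT (fun x => dl j x ^+ 2 * p i x)))).
  rewrite ler_wpM2l//.
  rewrite (eq_bigr (fun j => Rintegral mu setT (fun x => b j * (dl j x ^+ 2 * p i x)))); last first.
    by move=> j _; rewrite RintegralZl.
  rewrite -Rint_sum; last by move=> j _; exact: intgZ.
  rewrite -RintegralZl//; apply: Rint_le; last 1 first.
  - move=> x; apply: (le_trans (ler_wpM2r (p0 i x) (dec x))).
    rewrite -[leLHS]mulrA mulr_suml ler_wpM2l//; apply: ler_sum => j _.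
    by rewrite mulrA.
  - exact: (L2_intg (dp i) (L2B (dp i) (gbL _ _) (L2_cst (dp i) _))).
  - exact: intgZ.
rewrite [leLHS]mulrCA (mulrC 3) -[leRHS]mulrA ler_wpM2l// /Ntot !mulr_sumr.
apply: ler_sum => j _; rewrite /b; case: ltnP => ji; last first.
  rewrite mul0r mulr0 mulr_ge0// !addr_ge0//.
  by apply: Rintegral_ge0 => x _; rewrite mulr_ge0 ?sqr_ge0.
rewrite mul1r; apply: le_trans (step j).
(* What is left is to pass from [p i] to [p (inord j.+1)] at the price of [gam], which [hgam] allows
   because [j.+1 <= i]. *)
rewrite (mulrC gam) -mulrA ler_wpM2l//; first by case/andP: del01.
have jn : (j.+1 < n.+1)%N by rewrite ltnS.
have hg A : A \in s (inord j.+1) ->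
    gam * Rintegral mu A (p i) <= Rintegral mu A (p (inord j.+1)).
  by move=> As; apply: hgam => //; rewrite inordK.
by have [] := Rint_part_le (ps (inord j.+1)) (@ms _)
  (fun x => sqr_ge0 (dl j x)) (fun A x y As Ax Ay => congr1 (fun z => z ^+ 2)
    (dl_const As Ax Ay)) (density_intg (dp i)) (density_intg (dp (inord j.+1))) hg.
Qed.

(** [E1] bounds the Dirichlet form below by [W] and [DD], [HX] bounds the step costs by these two
    quantities, and [HV] bounds the variance by [W] and the step costs. *)
Lemma tempering_gap :
  rr ^+ 2 * gam * del / (32 * n.+1%:R ^+ 3) * gmin * Var_st mu p r g <=
  Dirichlet_st mu Ps p r g.
Proof.
have [N NE] : exists N : R, n.+1%:R = N by exists n.+1%:R.
rewrite NE.
pose W := \sum_(i < n.+1) r i * V i.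
pose DD := \sum_(j < n) swap_form (inord j.+1) (inord j).
have nN : n%:R = N - 1 by rewrite -NE -natr1 addrK.
have N1 : 1 <= N by rewrite -NE ler1n.
have N0 : 0 < N by exact: lt_le_trans ltr01 N1.
have hrrN i : rr <= N * r i by rewrite -NE.
have W0 : 0 <= W by apply: sumr_ge0 => i _; rewrite mulr_ge0// ltW.
have DD0 : 0 <= DD by apply: sumr_ge0 => i _; exact: swap_form_ge0.
have [ga0 ga1] := andP gam01; have [de0 de1] := andP del01.
have [rr0 rr1] := andP rr01; have [gm0 gm2] := andP gmin02.
have E1 : 2^-1 * (gmin * W) + 2^-1 * (N^-1 * DD) <= Dirichlet_st mu Ps p r g.
  rewrite Dirichlet_stE lerD//.
    rewrite ler_wpM2l// mulr_sumr; apply: ler_sum => i _.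
    by rewrite mulrCA ler_wpM2l ?(ltW (r0 i)).
  rewrite NE (_ : 2^-1 * (N^-1 * DD) = 4^-1 * (N^-1 * (2 * DD))).
    by rewrite !ler_wpM2l ?invr_ge0 ?(ltW N0)//; exact: swap_form_adj.
  by field; rewrite gt_eqF.
(* Each [V i] occurs at most twice in [Ntot], as the upper and as the lower level of a step; [hrr]
   turns the unweighted sum into one weighted by [r]. *)
have HX : rr * Ntot <= N * (2 * W + DD).
  have a1 : rr * \sum_(j < n) V (inord j.+1) <= N * W.
    rewrite /W big_ord_recl mulrDr mulr_sumr mulr_sumr -[leLHS]add0r lerD//.
      by apply: mulr_ge0; [exact: ltW|apply: mulr_ge0 => //; exact: ltW].
    apply: ler_sum => j _; rewrite mulrA.
    have -> : inord j.+1 = lift ord0 j by apply: val_inj; rewrite /= inordK// ltnS.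
    by rewrite ler_wpM2r// hrrN.
  have a2 : rr * \sum_(j < n) V (inord j) <= N * W.
    rewrite /W big_ord_recr/= mulrDr mulr_sumr mulr_sumr -[leLHS]addr0 lerD//; last first.
      by apply: mulr_ge0; [exact: ltW|apply: mulr_ge0 => //; exact: ltW].
    apply: ler_sum => j _; rewrite mulrA.
    have -> : inord j = widen_ord (leqnSn n) j.
      by apply: val_inj; rewrite /= inordK// ltnW// ltnS.
    by rewrite ler_wpM2r// hrrN.
  (* Both levels satisfy [rr <= N * r i], so the bound passes to the minimum of the weighted
     densities. *)
  have a3 : rr * \sum_(j < n) Q j <= N * DD.
    rewrite /DD !mulr_sumr; apply: ler_sum => j _.
    rewrite /Q /swap_form -!RintegralZl//; last exact: sqr_intg.
    apply: Rint_le => //; [exact: intgZ|by apply: intgZ; exact: sqr_intg|].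
    move=> x; rewrite [leLHS]mulrA [leRHS]mulrA ler_wpM2r ?sqr_ge0//.
    rewrite (minr_pMr _ _ (le_trans ler01 N1)) le_min !mulrA.
    by apply/andP; split; apply: ler_pM.
  rewrite /Ntot !big_split/= !mulrDr; lra.
(* The factors 2 come from splitting [g i x - c] at the cell average. The bound from [level] is the
   same for all levels, so there the weights sum to 1. *)
have HV : gam * del * Var_st mu p r g <= gam * del * (2 * W) + 2 * (3 * n%:R * Ntot).
  have gd : 0 <= gam * del by rewrite mulr_ge0.
  apply: (le_trans (ler_wpM2l gd (Var_st_le (gb ord0 point)))).
  have iV i : intg mu (fun x => (g i x - gb i x) ^+ 2 * p i x).
    exact: (L2_intg (dp i) (L2B (dp i) (gL i) (gbL _ _))).
  have iG i : intg mu (fun x => (gb i x - gb ord0 point) ^+ 2 * p i x).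
    exact: (L2_intg (dp i) (L2B (dp i) (gbL _ _) (L2_cst (dp i) _))).
  pose G i := Rintegral mu setT (fun x => (gb i x - gb ord0 point) ^+ 2 * p i x).
  have b1 i : Rintegral mu setT (fun x => (g i x - gb ord0 point) ^+ 2 * p i x) <=
      2 * V i + 2 * G i.
    rewrite /V /G -!RintegralZl// -RintegralD//; [|exact: intgZ|exact: intgZ].
    apply: Rint_le.
    - exact: (L2_intg (dp i) (L2B (dp i) (gL i) (L2_cst (dp i) _))).
    - by apply: intgD; exact: intgZ.
    move=> x; rewrite !mulrA -mulrDl ler_wpM2r//.
    by have := sqr_ge0 (g i x - gb i x - (gb i x - gb ord0 point)); nra.
  apply: (@le_trans _ _ (gam * del * \sum_(i < n.+1) r i * (2 * V i + 2 * G i))).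
    rewrite ler_wpM2l//; apply: ler_sum => i _; rewrite ler_wpM2l ?(ltW (r0 i))//.
  under eq_bigr do rewrite mulrDr (mulrCA _ 2) [in X in _ + X](mulrCA _ 2).
  rewrite big_split/= -!mulr_sumr mulrDr lerD// mulrCA ler_wpM2l//.
  rewrite mulr_sumr -[leRHS]mul1r -[X in _ <= X * _]r1 mulr_suml; apply: ler_sum => i _.
  by rewrite mulrCA ler_wpM2l ?(ltW (r0 i))//; exact: level.
apply: le_trans E1.
have N3 : 0 < 32 * N ^+ 3 by rewrite mulr_gt0// exprn_gt0.
rewrite [leLHS](_ : _ = (rr ^+ 2 * gam * del * gmin * Var_st mu p r g) / (32 * N ^+ 3)); last first.
  by ring.
rewrite ler_pdivrMr//.
have HN : rr * (2 * (3 * n%:R * Ntot)) <= 6 * (N - 1) * (N * (2 * W + DD)).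
  rewrite nN; have : 0 <= N - 1 by lra.
  by move=> h; have := ler_wpM2l h HX; nra.
(* One factor [rr] is spent on [HX]; in front of [2 * W] the product with [gam * del] is at most 1.
   The other factor [rr] is bounded by 1 in [R2]. *)
have M1 : rr * (gam * del * Var_st mu p r g) <= 2 * W + 6 * (N - 1) * (N * (2 * W + DD)).
  apply: (le_trans (ler_wpM2l rr0 HV)); rewrite mulrDr; apply: lerD => //.
  rewrite [leLHS]mulrA; apply: ler_piMl; first by rewrite mulr_ge0.
  by rewrite mulr_ile1// ?mulr_ge0// mulr_ile1.
have rg : 0 <= rr * gmin by rewrite mulr_ge0.
rewrite [leLHS](_ : _ = rr * gmin * (rr * (gam * del * Var_st mu p r g))); last by ring.
apply: (le_trans (ler_wpM2l rg M1)).
rewrite [leRHS](_ : _ = 16 * N ^+ 3 * (gmin * W) + 16 * N ^+ 2 * DD); last first.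
  by field; rewrite gt_eqF.
have W2 : 0 <= gmin * W by rewrite mulr_ge0.
have R2 : rr * gmin <= gmin by rewrite ler_piMl.
have B0 : 0 <= 2 * W + 6 * (N - 1) * (N * (2 * W + DD)).
  have ? : 0 <= N - 1 by lra.
  have ? : 0 <= 2 * W + DD by rewrite addr_ge0// mulr_ge0.
  by rewrite addr_ge0 ?mulr_ge0// ltW.
apply: (le_trans (ler_wpM2r B0 R2)).
have -> : gmin * (2 * W + 6 * (N - 1) * (N * (2 * W + DD))) =
  (2 + 12 * (N - 1) * N) * (gmin * W) + gmin * DD * (6 * (N - 1) * N) by ring.
(* [DD] enters [E1] without the factor [gmin], so here the gap is replaced by its upper bound 2. *)
have D2 : gmin * DD <= 2 * DD by rewrite ler_wpM2r.
(* For [N >= 1] the coefficients compare as [2 + 12 (N - 1) N <= 16 N^3] for [W] and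
   [12 (N - 1) N <= 16 N^2] for [DD]; the 16 is half of 32. *)
apply: lerD.
  rewrite ler_wpM2r//.
  have : 0 <= (N - 1) * N ^+ 2 by rewrite mulr_ge0 ?sqr_ge0//; lra.
  by rewrite exprS; nra.
have : 0 <= 6 * (N - 1) * N by rewrite !mulr_ge0//; lra.
move=> h; apply: (le_trans (ler_wpM2r h D2)).
by rewrite [leLHS]mulrAC; apply: ler_wpM2r => //; nra.
Qed.

End tempering.

(** Makes the infimum in [Gap_st] range over a nonempty set when there are at least two levels. The
    indicator of level 0 has variance [r_0 (1 - r_0)]. *)
Lemma Var_st_gt0 d (T : measurableType d) (R : realType)
    (mu : {measure set T -> \bar R}) (n : nat) (p : 'I_n.+1 -> T -> R)
    (r : 'I_n.+1 -> R) :
  (0 < n)%N -> (forall i, is_density mu (p i)) -> (forall i, 0 < r i) ->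
  \sum_(i < n.+1) r i = 1 ->
  exists2 g, L2_st mu p g & 0 < Var_st mu p r g.
Proof.
move=> n0 dp r0 r1; pose g (i : 'I_n.+1) (x : T) : R := (i == ord0)%:R.
exists g; first by move=> i; exact: L2_cst.
have Rc i (c : R) : Rintegral mu setT (fun x => c * p i x) = c.
  by rewrite RintegralZl// ?(Rint_density (dp i)) ?mulr1//; exact: density_intg.
have mE : mean_st mu p r g = r ord0.
  rewrite /mean_st /g; under eq_bigr do rewrite Rc.
  rewrite (bigD1 ord0)//= mulr1 big1 ?addr0// => i /negbTE ->.
  by rewrite mulr0.
rewrite /Var_st /ip_st mE /g; under eq_bigr do rewrite Rc.
have r01 : r ord0 < 1.
  rewrite -r1 (bigD1 ord0)//= ltrDl (bigD1 ord_max)/= ?ltr_wpDr//; last first.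
    by rewrite -val_eqE /= -lt0n.
  by apply: sumr_ge0 => i _; exact: ltW.
rewrite (bigD1 ord0)//= ltr_wpDr//.
  apply: sumr_ge0 => i _; rewrite mulr_ge0 ?(ltW (r0 i))//.
  by rewrite -expr2 sqr_ge0.
by rewrite mulr_gt0// mulr_gt0// subr_gt0.
Qed.

(** * The parameters as infima and the gap bound *)

Theorem mainTheorem2 (d : measure_display) (T : measurableType d) (R : realType)
  (mu : {measure set T -> \bar R}) (L : nat)
  (Ps : 'I_L -> R.-pker T ~> T) (p : 'I_L -> T -> R) (r : 'I_L -> R)
  (Part : 'I_L -> set (set T)) :
  (0 < L)%N ->
  (forall i, is_density mu (p i)) ->
  (forall i, stationary mu (Ps i) (p i)) ->
  (forall i, reversible mu (Ps i) (p i)) ->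
  (forall i, 0 < r i) -> \sum_(i < L) r i = 1 ->
  (forall i, good_partition mu (p i) (Part i)) ->
  (forall i : 'I_L, nat_of_ord i = 0%N -> Part i = [set setT]) ->
  (forall i j : 'I_L, nat_of_ord i = j.+1 ->
     forall A, Part i A -> exists2 B, Part j B & A `<=` B) ->
  let rr := inf (range r) / sup (range r) in
  (* x = (i, j, A) with i = j+1 (paper: i and i-1), A in P_i *)
  let delta := inf [set Rintegral mu x.2 (fun y => Num.min (p x.1.2 y) (p x.1.1 y))
                          / pmass mu (p x.1.1) x.2
                   | x in [set x : 'I_L * 'I_L * set T |
                           nat_of_ord x.1.1 = (x.1.2).+1 /\ Part x.1.1 x.2]] in
  (* x = (i1, i2, A) with i1 <= i2, A in P_i1 *)
  let gamma := inf [set pmass mu (p x.1.1) x.2 / pmass mu (p x.1.2) x.2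
                   | x in [set x : 'I_L * 'I_L * set T |
                           (x.1.1 <= x.1.2)%N /\ Part x.1.1 x.2]] in
  (* x = (i, A) with A in P_i *)
  let gmin := inf [set Gap_restr mu (Ps x.1) (p x.1) x.2
                   | x in [set x : 'I_L * set T | Part x.1 x.2]] in
  rr ^+ 2 * gamma * delta / (32 * (L%:R) ^+ 3) * gmin <= Gap_st mu Ps p r.
Proof.
case: L Ps p r Part => [|n] Ps p r Part; first by rewrite ltnn.
move=> _ dp _ rev r0 r1 gp part0 ref; cbv zeta.
set rr := (X in X ^+ 2); set gamma := (X in _ ^+ 2 * X).
set delta := (X in _ ^+ 2 * _ * X); set gmin := (X in _ / _ * X <= _).
have p0 i x : 0 <= p i x by case: (dp i) => _ [].
have pm0 i A : 0 <= pmass mu (p i) A by apply: Rintegral_ge0.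
have PT : Part ord0 setT by rewrite part0.
have /choice[s sP] : forall i, exists t : seq (set T),
    (forall A, Part i A <-> A \in t) /\ is_part R t.
  by move=> i; have [t t1 t2] := good_partition_seq (gp i); exists t.
have hs i A : A \in s i -> measurable A /\ 0 < pmass mu (p i) A.
  by move=> /(sP i).1; case: (gp i) => _ [+ _]; exact.
have r_le1 i : r i <= 1.
  by rewrite -r1 (bigD1 i)//= lerDl; apply: sumr_ge0 => k _; exact: ltW.
have r_ge i : inf (range r) <= r i.
  by apply: inf_le_ge0; [move=> _ [k _ <-]; exact: ltW|exists i].
have r_le i : r i <= sup (range r).
  by apply: ub_le_sup; [exists 1 => _ [k _ <-]|exists i].
have infr0 : 0 <= inf (range r) by apply: inf_ge0 => _ [k _ <-]; exact: ltW.
have sup0 : 0 < sup (range r) := lt_le_trans (r0 ord0) (r_le ord0).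
have rr01 : 0 <= rr <= 1.
  rewrite divr_ge0 ?(ltW sup0)//= ler_pdivrMr// mul1r.
  exact: le_trans (r_ge ord0) (r_le ord0).
(* The weights sum to 1, so the largest is at least [1/L], and dividing by the supremum costs at
   most a factor [L]. *)
have hrr i : rr <= n.+1%:R * r i.
  rewrite ler_pdivrMr// mulrAC; apply: (le_trans (r_ge i)).
  rewrite ler_peMl ?(ltW (r0 i))// mulr_natl -[leLHS]r1 -[X in _ *+ X](card_ord n.+1).
  by rewrite -sumr_const; apply: ler_sum.
have hgam (i1 i2 : 'I_n.+1) A : (i1 <= i2)%N -> A \in s i1 ->
    gamma * pmass mu (p i2) A <= pmass mu (p i1) A.
  (* A cell may be null for the density of another level; its quotient is then 0 by convention, and
     the product form is immediate. *)
  move=> i12 As; have [->|A0] := eqVneq (pmass mu (p i2) A) 0.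
    by rewrite mulr0.
  have {}A0 : 0 < pmass mu (p i2) A by rewrite lt_neqAle eq_sym A0 pm0.
  rewrite -ler_pdivlMr//; apply: inf_le_ge0.
    by move=> _ [x _ <-]; rewrite divr_ge0.
  by exists (i1, i2, A) => //; split => //; exact/(sP i1).1.
have pT i : pmass mu (p i) setT = 1 by exact: (Rint_density (dp i)).
have gam01 : 0 <= gamma <= 1.
  apply/andP; split; first by apply: inf_ge0 => _ [x _ <-]; rewrite divr_ge0.
  (* The whole space at level 0, compared with itself, has quotient 1. *)
  have := hgam ord0 ord0 setT (leqnn _) (((sP ord0).1 setT).1 PT).
  by rewrite !pT mulr1.
have min0 i j A : 0 <= Rintegral mu A (fun y => Num.min (p j y) (p i y)).
  by apply: Rintegral_ge0 => x _; rewrite le_min !p0.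
have del_ge0 x : [set Rintegral mu x.2 (fun y => Num.min (p x.1.2 y) (p x.1.1 y))
    / pmass mu (p x.1.1) x.2 | x in [set x : 'I_n.+1 * 'I_n.+1 * set T |
    nat_of_ord x.1.1 = (x.1.2).+1 /\ Part x.1.1 x.2]] x -> 0 <= x.
  by move=> [y _ <-]; rewrite divr_ge0.
have hdel (i j : 'I_n.+1) A : nat_of_ord i = j.+1 -> A \in s i ->
    delta * pmass mu (p i) A <= Rintegral mu A (fun x => Num.min (p j x) (p i x)).
  move=> ij As; have [_ A0] := hs _ _ As.
  rewrite -ler_pdivlMr//; apply: inf_le_ge0 => //.
  by exists (i, j, A) => //; split => //; exact/(sP i).1.
have hgm0 x : [set Gap_restr mu (Ps x.1) (p x.1) x.2
    | x in [set x : 'I_n.+1 * set T | Part x.1 x.2]] x -> 0 <= x.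
  move=> [[i A] /= /(sP i).1 /hs[mA A0] <-]; exact: (Gap_restr_ge0 (dp i) (rev i)).
have hgmin i A : A \in s i -> gmin <= Gap_restr mu (Ps i) (p i) A.
  by move=> As; apply: inf_le_ge0 => //; exists (i, A) => //=; exact/(sP i).1.
have gmin02 : 0 <= gmin <= 2.
  rewrite inf_ge0//=; have As : setT \in s ord0 by exact/(sP ord0).1.
  have [mA A0] := hs _ _ As.
  exact: (le_trans (hgmin _ _ As) (Gap_restr_le2 (dp ord0) (rev ord0) mA A0)).
(* With a single level, delta is the infimum of the empty set, that is 0. *)
have [n0|n_gt0] := posnP n.
  rewrite (_ : delta = 0); last first.
    rewrite /delta (_ : [set _ | _ in _] = set0) ?inf0// -subset0.
    move=> _ [[[i j] A] /= [ij _] _].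
    by have := ltn_ord i; rewrite ij ltnS [X in (_ < X)%N]n0.
  rewrite mulr0 !mul0r; apply: inf_ge0 => _ [g [gL gV] <-].
  by rewrite divr_ge0 ?(ltW gV)//; exact: Dirichlet_st_ge0.
have del01 : 0 <= delta <= 1.
  rewrite inf_ge0//=.
  (* Any cell of level 1 gives a quotient at most 1, since the minimum of the two densities lies
     below that of level 1. *)
  have [A [As _ _ _]] := (sP (inord 1)).2 point.
  have [mA A0] := hs _ _ As.
  have /(hdel _ ord0) : nat_of_ord (inord 1 : 'I_n.+1) = 1%N by rewrite inordK.
  move=> /(_ _ As) h; rewrite -(ler_pM2r A0) mul1r; apply: (le_trans h).
  rewrite /pmass [leLHS]Rint_indic [leRHS]Rint_indic; apply: Rint_le.
  - apply: intg_indic => //.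
    apply: (intg_le _ (density_intg (dp ord0))).
      by apply: measurable_minr; [case: (dp ord0)|case: (dp (inord 1))].
    by move=> x; rewrite ger0_norm ?le_min ?p0// ge_min lexx.
  - by apply: intg_indic => //; exact: density_intg.
  - by move=> x; rewrite ler_wpM2l// ge_min lexx orbT.
have [g0 g0L g0V] := Var_st_gt0 n_gt0 dp r0 r1.
apply: lb_le_inf; first by exists (Dirichlet_st mu Ps p r g0 / Var_st mu p r g0), g0.
move=> _ [g [gL gV] <-]; rewrite ler_pdivlMr//.
apply: (tempering_gap dp rev r0 r1 gL (s := s)) => //.
- by move=> i; exact: (sP i).2.
- exact/(sP ord0).1.
- move=> j A /(sP _).1; have jn : (j.+1 < n.+1)%N by rewrite ltnS.
  move=> /(ref _ (inord j)) [|B PB AB]; first by rewrite !inordK// ltnW.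
  by exists B => //; exact/(sP _).1.
- move=> j A As; have jn : (j.+1 < n.+1)%N by rewrite ltnS.
  by apply: hdel => //; rewrite !inordK// ltnW.
Qed.
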